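(* Let $G$ be a finite group, $k$ an algebraically closed field of characteristic zero, and $\omega\in Z^3(G,k^\times)$ a normalized $3$-cocycle. The fusion subcategories of the representation category $\operatorname{Rep}(D^\omega(G))$ of the twisted quantum double $D^\omega(G)$ are in bijection with the triples $(K,H,B)$, where $K,H$ are normal subgroups of $G$ centralizing each other and $B:K\times H\to k^\times$ is a $G$-invariant $\omega$-bicharacter.
   Context: A normalized 3-cocycle is a map $\omega:G\times G\times G\to k^\times$ with $\omega(g_2,g_3,g_4)\,\omega(g_1,g_2g_3,g_4)\,\omega(g_1,g_2,g_3)=\omega(g_1g_2,g_3,g_4)\,\omega(g_1,g_2,g_3g_4)$ and $\omega(g,e,l)=1$, where $e$ is the identity of $G$. Put $$\beta_a(x,y)=\frac{\omega(a,x,y)\,\omega(x,y,y^{-1}x^{-1}axy)}{\omega(x,x^{-1}ax,y)}\qquad(a,x,y\in G).$$ $D^\omega(G)$ is the Dijkgraaf--Pasquier--Roche quasi-triangular quasi-Hopf algebra; its category $\operatorname{Rep}(D^\omega(G))$ of finite-dimensional modules is a modular fusion category, braided equivalent to the center $\mathcal{Z}(\operatorname{Vec}_G^\omega)$ of the fusion category $\operatorname{Vec}_G^\omega$ of finite-dimensional $G$-graded $k$-vector spaces with associativity constraint given by $\omega$. A fusion subcategory is a full subcategory, closed under isomorphism, that contains the unit object and is closed under finite direct sums, direct summands, tensor products and duals. Let $K,H$ be normal subgroups of $G$ that centralize each other (i.e. commute elementwise). A function $B:K\times H\to k^\times$ is an $\omega$-bicharacter if (i) $B(x,yz)=\beta_x(y,z)^{-1}B(x,y)B(x,z)$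 and (ii) $B(wx,y)=\beta_y(w,x)B(w,y)B(x,y)$ for all $w,x\in K$, $y,z\in H$. It is $G$-invariant if $$B(x^{-1}kx,h)=\frac{\beta_k(x,h)\,\beta_k(xh,x^{-1})}{\beta_k(x,x^{-1})}\,B(k,xhx^{-1})$$ for all $x\in G$, $k\in K$, $h\in H$. *)

(* Defs.v *)
From HB Require Import structures.
From mathcomp Require Import all_boot all_order all_algebra all_fingroup.
From mathcomp Require Import mxtens ring.

Set Implicit Arguments.
Unset Strict Implicit.
Unset Printing Implicit Defensive.

Import GRing.Theory.
Local Open Scope group_scope.
Local Open Scope ring_scope.

Record normalized_cocycle3 (gT : finGroupType) (k : fieldType) := Cocycle3 {
  cocycle3_fun :> gT -> gT -> gT -> k;
  cocycle3_neq0 : forall a b c, cocycle3_fun a b c != 0;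
  cocycle3_eq : forall a b c d,
    cocycle3_fun b c d * cocycle3_fun a (b * c)%g d * cocycle3_fun a b c =
    cocycle3_fun (a * b)%g c d * cocycle3_fun a b (c * d)%g;
  cocycle3_norm : forall a b, cocycle3_fun a 1%g b = 1 }.

Lemma eq_of_ratio (k : fieldType) (u v l r : k) :
  l = r -> r != 0 -> u * r = v * l -> u = v.
Proof. by move=> -> r0 /(mulIf r0). Qed.

Section TwistedCochains.
Variables (gT : finGroupType) (k : fieldType) (w : normalized_cocycle3 gT k).
Implicit Types a b c x y z : gT.

Definition beta a x y : k :=
  w a x y * w x y (y^-1 * x^-1 * a * x * y)%g / w x (x^-1 * a * x)%g y.

(* The coefficients of the coproduct: the 2-cochains with which beta_(a b) is
   cohomologous to beta_a beta_b, see [beta_gamma]. *)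
Definition gamma x a b : k :=
  w a b x * w x (x^-1 * a * x)%g (x^-1 * b * x)%g / w a x (x^-1 * b * x)%g.

Lemma cocycle3_1l a b : w 1%g a b = 1.
Proof.
have := cocycle3_eq w 1%g 1%g a b; rewrite !mul1g !cocycle3_norm mulr1.
by move=> e; apply: (mulfI (cocycle3_neq0 w 1%g a b)); rewrite e mulr1.
Qed.

Lemma cocycle3_1r a b : w a b 1%g = 1.
Proof.
have := cocycle3_eq w a b 1%g 1%g; rewrite !mulg1 !cocycle3_norm !mul1r.
by move=> e; apply: (mulfI (cocycle3_neq0 w a b 1%g)); rewrite e mulr1.
Qed.

Lemma beta_neq0 a x y : beta a x y != 0.
Proof. by rewrite !mulf_neq0 ?invr_eq0 ?cocycle3_neq0. Qed.

Lemma gamma_neq0 x a b : gamma x a b != 0.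
Proof. by rewrite !mulf_neq0 ?invr_eq0 ?cocycle3_neq0. Qed.

Lemma betaE a x y : beta a x y =
  w a x y * w x y (a ^ (x * y))%g / w x (a ^ x)%g y.
Proof. by rewrite /beta /conjg invMg !mulgA. Qed.

Lemma gammaE x a b : gamma x a b =
  w a b x * w x (a ^ x)%g (b ^ x)%g / w a x (b ^ x)%g.
Proof. by rewrite /gamma /conjg !mulgA. Qed.

Lemma beta_1l x y : beta 1%g x y = 1.
Proof.
by rewrite betaE !conj1g cocycle3_1l cocycle3_1r cocycle3_norm !mulr1 divr1.
Qed.

Lemma beta_1 a y : beta a 1%g y = 1.
Proof.
by rewrite betaE !mul1g cocycle3_norm !cocycle3_1l !mulr1 divr1.
Qed.

Lemma beta_1r a x : beta a x 1%g = 1.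
Proof.
by rewrite betaE !cocycle3_1r cocycle3_norm !mulr1 divr1.
Qed.

Lemma gamma_1 a b : gamma 1%g a b = 1.
Proof.
by rewrite gammaE !conjg1 cocycle3_norm cocycle3_1l cocycle3_1r mulr1 divr1.
Qed.

Lemma beta_cocycle a x y z :
  beta a x y * beta a (x * y)%g z = beta (a ^ x)%g y z * beta a x (y * z)%g.
Proof.
rewrite !betaE -!conjgM !mulgA.
have nz := cocycle3_neq0 w.
have sq (u v : gT) : (u * v = v * (u ^ v))%g by apply: conjgC.
set b := (a ^ x)%g; set c := (a ^ (x * y))%g; set d := (a ^ (x * y * z))%g.
have e1 := cocycle3_eq w a x y z.
have e2 := cocycle3_eq w x b y z.
have e3 := cocycle3_eq w x y c z.
have e4 := cocycle3_eq w x y z d.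
have ax : (a * x = x * b)%g := sq a x.
have cE : (b * y = y * c)%g by rewrite /c conjgM; apply: sq.
have dE : (c * z = z * d)%g by rewrite /d conjgM; apply: sq.
rewrite ax in e1; rewrite cE in e2; rewrite dE in e3.
have {}e1 : w (x * b)%g y z =
  w x y z * w a (x * y)%g z * w a x y / w a x (y * z)%g.
  by rewrite e1 mulfK.
have {}e3 : w x (y * c)%g z =
  w (x * y)%g c z * w x y (z * d)%g / (w y c z * w x y c).
  by rewrite -e3; field; rewrite !nz.
have {}e4 : w x y (z * d)%g =
  w y z d * w x (y * z)%g d * w x y z / w (x * y)%g z d.
  by rewrite e4; field; rewrite !nz.
rewrite e1 e3 e4 in e2.
by apply: (eq_of_ratio (esym e2)); last field; rewrite ?(mulf_neq0, invr_eq0, nz).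
Qed.

(* This makes the coproduct multiplicative. *)
Lemma beta_gamma a b x y :
  gamma x a b * gamma y (a ^ x)%g (b ^ x)%g * (beta a x y * beta b x y) =
  beta (a * b)%g x y * gamma (x * y)%g a b.
Proof.
rewrite !betaE !gammaE -!conjgM !(conjMg a b).
have nz := cocycle3_neq0 w.
have sq (u v : gT) : (u * v = v * (u ^ v))%g by apply: conjgC.
set a1 := (a ^ x)%g; set a2 := (a ^ (x * y))%g.
set b1 := (b ^ x)%g; set b2 := (b ^ (x * y))%g.
have ax : (a * x = x * a1)%g := sq a x.
have bx : (b * x = x * b1)%g := sq b x.
have ay : (a1 * y = y * a2)%g by rewrite /a2 conjgM; apply: sq.
have b_y : (b1 * y = y * b2)%g by rewrite /b2 conjgM; apply: sq.
have e1 := cocycle3_eq w a b x y.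
have e2 := cocycle3_eq w a x b1 y.
have e3 := cocycle3_eq w a x y b2.
have e4 := cocycle3_eq w x a1 b1 y.
have e5 := cocycle3_eq w x a1 y b2.
have e6 := cocycle3_eq w x y a2 b2.
rewrite ?ax ?bx ?ay ?b_y in e1 e2 e3 e4 e5 e6.
have {}e1 := congr2 ( *%R) (congr2 ( *%R) e1 (esym e2)) e3.
have {}e4 := congr2 ( *%R) (congr2 ( *%R) e4 (esym e5)) e6.
have {e4}e1 := congr2 ( *%R) e1 e4.
by apply: (eq_of_ratio e1); last field; rewrite ?(mulf_neq0, invr_eq0, nz).
Qed.

End TwistedCochains.

(* [d (a, x)] is the coefficient of d on the basis element delta_a x. The algebra
   structure depends on the cocycle w. *)
Definition twisted_double (gT : finGroupType) (k : fieldType)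
  (w : normalized_cocycle3 gT k) : Type := {ffun gT * gT -> k^o}.

Section TwistedDoubleAlgebra.
Variables (gT : finGroupType) (k : fieldType) (w : normalized_cocycle3 gT k).
Local Notation D := (twisted_double w).
Local Notation beta := (beta w).
Implicit Types (a b x y : gT) (d : D).

HB.instance Definition _ := GRing.Lmodule.copy D {ffun gT * gT -> k^o}.

Definition td_basis a x : D := [ffun u => (u == (a, x))%:R].

(* The bilinear extension of [td_basisM] below. *)
Definition td_mul (d1 d2 : D) : D := [ffun u : gT * gT =>
  \sum_(x : gT) d1 (u.1, x) * d2 (u.1 ^ x, x^-1 * u.2)%g
                * beta u.1 x (x^-1 * u.2)%g].

Definition td_one : D := [ffun u : gT * gT => (u.2 == 1%g)%:R].

Lemma td_mulA : associative td_mul.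
Proof.
move=> d1 d2 d3; apply/ffunP=> -[a z]; rewrite !ffunE /=.
under eq_bigr do rewrite !ffunE /= mulr_sumr mulr_suml.
under [RHS]eq_bigr do rewrite !ffunE /= !mulr_suml.
rewrite [RHS]exchange_big; apply: eq_bigr => x _ /=.
rewrite [RHS](reindex_inj (mulgI x)) /=; apply: eq_bigr => y _.
have := beta_cocycle w a x y (y^-1 * (x^-1 * z))%g.
rewrite mulKVg mulKg invMg !mulgA -!conjgM => e.
transitivity (d1 (a, x) * d2 (a ^ x, y)%g * d3 (a ^ (x * y), y^-1 * x^-1 * z)%g
  * (beta (a ^ x)%g y (y^-1 * x^-1 * z)%g * beta a x (x^-1 * z)%g)).
  by rewrite !mulrA.
by rewrite -e; ring.
Qed.

Lemma td_mul1d : left_id td_one td_mul.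
Proof.
move=> d; apply/ffunP=> -[a z]; rewrite !ffunE (bigD1 1%g) //= ffunE eqxx.
rewrite big1 ?addr0 => [|x /negPf x1]; last by rewrite ffunE /= x1 !mul0r.
by rewrite invg1 mul1g conjg1 beta_1 mul1r mulr1.
Qed.

Lemma td_muld1 : right_id td_one td_mul.
Proof.
move=> d; apply/ffunP=> -[a z]; rewrite !ffunE (bigD1 z) //= ffunE /= mulVg eqxx.
rewrite big1 ?addr0 => [|x /negPf xz]; last first.
  by rewrite ffunE /= -eq_mulVg1 xz mulr0 mul0r.
by rewrite beta_1r !mulr1.
Qed.

Lemma td_mulDl : left_distributive td_mul +%R.
Proof.
move=> d1 d2 d3; apply/ffunP=> u; rewrite !ffunE -big_split /=.
by apply: eq_bigr => x _; rewrite ffunE !mulrDl.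
Qed.

Lemma td_mulDr : right_distributive td_mul +%R.
Proof.
move=> d1 d2 d3; apply/ffunP=> u; rewrite !ffunE -big_split /=.
by apply: eq_bigr => x _; rewrite ffunE mulrDr mulrDl.
Qed.

Lemma td_one_neq0 : td_one != 0.
Proof.
apply/eqP=> /ffunP/(_ (1, 1)%g); rewrite !ffunE eqxx => /eqP.
by rewrite oner_eq0.
Qed.

HB.instance Definition _ := GRing.Zmodule_isNzRing.Build D
  td_mulA td_mul1d td_muld1 td_mulDl td_mulDr td_one_neq0.

Lemma td_scaleAl (c : k) (d1 d2 : D) : c *: (d1 * d2) = (c *: d1) * d2.
Proof.
apply/ffunP=> u; rewrite !ffunE scaler_sumr.
by apply: eq_bigr => x _; rewrite ffunE /GRing.scale /= !mulrA.
Qed.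

Lemma td_scaleAr (c : k) (d1 d2 : D) : c *: (d1 * d2) = d1 * (c *: d2).
Proof.
apply/ffunP=> u; rewrite !ffunE scaler_sumr.
by apply: eq_bigr => x _; rewrite ffunE /GRing.scale /=; ring.
Qed.

HB.instance Definition _ := GRing.Lmodule_isLalgebra.Build k D td_scaleAl.
HB.instance Definition _ := GRing.Lalgebra_isAlgebra.Build k D td_scaleAr.

Lemma td_basisMJ a x b y : td_basis a x * td_basis b y =
  if (a ^ x)%g == b then beta a x y *: td_basis a (x * y)%g else 0.
Proof.
apply/ffunP=> -[c z]; rewrite ffunE (bigD1 x) //= big1 ?addr0; last first.
  by move=> t /negPf tx; rewrite ffunE xpair_eqE tx andbF !mul0r.
rewrite !ffunE !xpair_eqE eqxx andbT -(inj_eq (mulgI x) (x^-1 * z)%g) mulKVg.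
have [-> | ca] := eqVneq c a; last first.
  by case: ifP => _; rewrite !ffunE ?xpair_eqE ?(negPf ca) ?scaler0 !mul0r.
case: ifP => _; rewrite !ffunE ?xpair_eqE ?eqxx /= ?mulr0 ?mul0r // mul1r.
have [-> | _] := eqVneq z _; first by rewrite mulKg mul1r /GRing.scale /= mulr1.
by rewrite mul0r scaler0.
Qed.

Lemma td_basisM a x b y : td_basis a x * td_basis b y =
  if a == (x * b * x^-1)%g then beta a x y *: td_basis a (x * y)%g else 0.
Proof.
rewrite td_basisMJ; congr (if _ then _ else _).
by rewrite (can2_eq (conjgK x) (conjgKV x)) conjgE invgK mulgA.
Qed.

Lemma td_decomp d : d = \sum_(u : gT * gT) d u *: td_basis u.1 u.2.
Proof.
apply/ffunP=> v; rewrite sum_ffunE (bigD1 v) //= big1 ?addr0; last first.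
  by move=> u /negPf uv; rewrite !ffunE -surjective_pairing eq_sym uv scaler0.
by rewrite !ffunE -surjective_pairing eqxx /GRing.scale /= mulr1.
Qed.

Lemma td_1E : 1 = \sum_(a : gT) td_basis a 1%g :> D.
Proof.
apply/ffunP=> -[a x]; rewrite sum_ffunE (bigD1 a) //= big1 ?addr0.
  by rewrite !ffunE xpair_eqE eqxx.
by move=> b /negPf ba; rewrite ffunE xpair_eqE eq_sym ba.
Qed.

Lemma td_monoid_morphism n (f : {linear D -> 'M[k]_n}) :
    \sum_(a : gT) f (td_basis a 1%g) = 1%:M ->
    (forall a x b y, f (td_basis a x * td_basis b y) =
       f (td_basis a x) *m f (td_basis b y)) ->
  monoid_morphism f.
Proof.
move=> f1 fM; split=> [|d1 d2]; first by rewrite td_1E linear_sum.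
rewrite [in LHS](td_decomp d1) [in LHS](td_decomp d2) mulr_suml linear_sum.
rewrite [in RHS](td_decomp d1) linear_sum mulr_suml; apply: eq_bigr => u _.
rewrite mulr_sumr linear_sum [in RHS](td_decomp d2) [f (\sum_i _)]linear_sum mulr_sumr.
apply: eq_bigr => v _.
by rewrite -scalerAl -scalerAr !linearZ /= fM /GRing.mul /= -scalemxAl -scalemxAr.
Qed.

End TwistedDoubleAlgebra.

Lemma tensmx_suml (k : fieldType) (I : finType) m n p q
  (A : I -> 'M[k]_(m, n)) (B : 'M[k]_(p, q)) :
  (\sum_i A i) *t B = \sum_i (A i *t B).
Proof.
apply/matrixP=> i j; rewrite mxE !summxE mulr_suml.
by apply: eq_bigr => l _; rewrite mxE.
Qed.

Lemma tensmx_sumr (k : fieldType) (I : finType) m n p q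
  (A : 'M[k]_(m, n)) (B : I -> 'M[k]_(p, q)) :
  A *t (\sum_i B i) = \sum_i (A *t B i).
Proof.
apply/matrixP=> i j; rewrite mxE !summxE mulr_sumr.
by apply: eq_bigr => l _; rewrite mxE.
Qed.

Lemma tensmxZZ (k : fieldType) m n p q (c1 c2 : k)
  (A : 'M[k]_(m, n)) (B : 'M[k]_(p, q)) :
  (c1 *: A) *t (c2 *: B) = (c1 * c2) *: (A *t B).
Proof. by apply/matrixP=> i j; rewrite !mxE; ring. Qed.

Lemma tensmx_11 (k : fieldType) m n :
  (1%:M : 'M[k]_m) *t (1%:M : 'M[k]_n) = 1%:M.
Proof.
apply/matrixP=> i j.
case: (mxtens_indexP i) => i1 i2; case: (mxtens_indexP j) => j1 j2.
rewrite tensmxE !mxE (inj_eq (can_inj (@mxtens_indexK _ _))) xpair_eqE.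
by rewrite -natrM mulnb.
Qed.

Section QuasiHopf.
Variables (gT : finGroupType) (k : fieldType) (w : normalized_cocycle3 gT k).
Local Notation D := (twisted_double w).
Local Notation beta := (beta w).
Local Notation gamma := (gamma w).
Local Notation basis := (td_basis w).
Implicit Types (a b x y : gT) (d : D).

Definition td_counit d : k := \sum_(x : gT) d (1%g, x).

Lemma td_counit_linear : scalar td_counit.
Proof.
move=> c d1 d2; rewrite /td_counit mulr_sumr -big_split /=.
by apply: eq_bigr => x _; rewrite !ffunE.
Qed.

HB.instance Definition _ := GRing.isLinear.Build k D k _ td_counit
  td_counit_linear.

(* Coordinates of the coproduct in the basis of D (x) D:
   delta_a x |-> \sum_(b c = a) gamma_x(b, c) delta_b x (x) delta_c x. *)
Definition td_comul d : {ffun (gT * gT) * (gT * gT) -> k^o} := [ffun v =>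
  if v.1.2 == v.2.2 then d (v.1.1 * v.2.1, v.1.2)%g * gamma v.1.2 v.1.1 v.2.1
  else 0].

(* delta_a x |-> beta_(a^-1)(x, x^-1)^-1 gamma_x(a, a^-1)^-1
   delta_(x^-1 a^-1 x) x^-1. *)
Definition td_antipode d : D := \sum_(u : gT * gT) d u *:
  (((beta u.1^-1%g u.2 u.2^-1%g)^-1 * (gamma u.2 u.1 u.1^-1%g)^-1) *:
     basis (u.2^-1 * u.1^-1 * u.2)%g u.2^-1%g).

Lemma td_counit_basis a x : td_counit (basis a x) = (a == 1%g)%:R.
Proof.
rewrite /td_counit (bigD1 x) //= big1 ?addr0.
  by rewrite ffunE xpair_eqE eqxx andbT eq_sym.
by move=> y /negPf yx; rewrite ffunE xpair_eqE yx andbF.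
Qed.

Lemma td_antipode_basis a x : td_antipode (basis a x) =
  ((beta a^-1 x x^-1)%g * gamma x a a^-1%g)^-1 *: basis (a^-1 ^ x)%g x^-1%g.
Proof.
rewrite /td_antipode (bigD1 (a, x)) //= big1 ?addr0; last first.
  by move=> u /negPf ux; rewrite ffunE ux scale0r.
by rewrite ffunE eqxx scale1r /= -invfM conjgE mulgA.
Qed.

Lemma td_antipode_linear : linear td_antipode.
Proof.
move=> c d1 d2; rewrite /td_antipode scaler_sumr -big_split /=.
apply: eq_bigr => u _; rewrite !ffunE scalerDl. by rewrite [in RHS]scalerA.
Qed.

HB.instance Definition _ := GRing.isLinear.Build k D D _ td_antipode
  td_antipode_linear.

Lemma td_antipode1 : td_antipode 1 = 1.
Proof.
rewrite td_1E linear_sum (reindex_inj invg_inj) /=; apply: eq_bigr => a _.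
by rewrite td_antipode_basis invgK conjg1 invg1 beta_1 gamma_1 mulr1 invr1 scale1r.
Qed.

Lemma td_antipodeM_basis a x b y :
  td_antipode (basis a x * basis b y) =
  td_antipode (basis b y) * td_antipode (basis a x).
Proof.
rewrite !td_antipode_basis -scalerAl -scalerAr !td_basisMJ conjgK.
rewrite conjVg (inj_eq invg_inj) eq_sym.
have [<- | _] := eqVneq (a ^ x)%g b; last by rewrite linear0 !scaler0.
rewrite linearZ /= td_antipode_basis !scalerA -invMg -conjVg -conjgM; congr (_ *: _).
have bg := beta_gamma w a a^-1%g x y; rewrite mulgV beta_1l mul1r in bg.
have c1 := beta_cocycle w a^-1%g x y (x * y)^-1%g.
have c2 := beta_cocycle w (a^-1 ^ x)%g y y^-1%g x^-1%g.
rewrite mulgV beta_1 mulr1 -!conjgM -invMg in c2.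
have yx : (y * (x * y)^-1 = x^-1)%g by rewrite invMg mulKVg.
rewrite yx in c1.
have {bg c1 c2}e := congr2 ( *%R) (congr2 ( *%R) bg (esym c1)) c2.
by apply: (eq_of_ratio e); last field; rewrite ?(beta_neq0, gamma_neq0, mulf_neq0, invr_eq0).
Qed.

Lemma td_antipodeM d1 d2 :
  td_antipode (d1 * d2) = td_antipode d2 * td_antipode d1.
Proof.
rewrite [in LHS](td_decomp d1) [in LHS](td_decomp d2) mulr_suml linear_sum.
rewrite [in RHS](td_decomp d1) linear_sum mulr_sumr; apply: eq_bigr => u _.
rewrite mulr_sumr linear_sum [in RHS](td_decomp d2) linear_sum mulr_suml.
apply: eq_bigr => v _.
by rewrite -scalerAl -scalerAr !linearZ /= td_antipodeM_basis -scalerAr -scalerAl.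
Qed.

(* A finite-dimensional left module, in matrix form: [M d] is the matrix of the
   action of d on the column space k^n. *)
Record td_module := TDModule {
  td_dim : nat;
  td_act :> {lrmorphism D -> 'M[k]_td_dim} }.

Definition td_module_of n (f : D -> 'M[k]_n)
    (lf : linear f) (mf : monoid_morphism f) : td_module :=
  TDModule (HB.pack_for {lrmorphism D -> 'M[k]_n} f
    (GRing.isLinear.Build k D 'M[k]_n *:%R f lf)
    (GRing.isMonoidMorphism.Build D 'M[k]_n f mf)).

Implicit Types M N : td_module.

Definition td_hom M N (f : 'M[k]_(td_dim N, td_dim M)) : Prop :=
  forall d, f *m M d = N d *m f.

Definition td_iso M N : Prop :=
  exists (f : 'M[k]_(td_dim N, td_dim M)) (g : 'M[k]_(td_dim M, td_dim N)),
    [/\ td_hom f, td_hom g, g *m f = 1%:M & f *m g = 1%:M].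

Lemma td_actM M d1 d2 : M (d1 * d2) = M d1 *m M d2.
Proof. exact: rmorphM. Qed.

Lemma td_act1 M : M 1 = 1%:M.
Proof. exact: rmorph1. Qed.

Lemma td_act_sum1 M : \sum_(a : gT) M (basis a 1%g) = 1%:M.
Proof. by rewrite -td_act1 td_1E linear_sum. Qed.

Definition unit_act d : 'M[k]_1 := (td_counit d)%:M.

Lemma unit_act_linear : linear unit_act.
Proof. by move=> c d1 d2; rewrite /unit_act linearP raddfD /= scale_scalar_mx. Qed.

HB.instance Definition _ := GRing.isLinear.Build k D 'M[k]_1 _ unit_act
  unit_act_linear.

Lemma unit_act_monoid_morphism : monoid_morphism unit_act.
Proof.
apply: td_monoid_morphism => [|a x b y].
  rewrite /= /unit_act (bigD1 1%g) //= td_counit_basis eqxx big1 ?addr0 //.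
  by move=> a /negPf a1; rewrite td_counit_basis a1 raddf0.
rewrite /= /unit_act -scalar_mxM; congr _%:M; rewrite !td_counit_basis td_basisMJ.
have [-> | /negPf a1] := eqVneq a 1%g; last first.
  by rewrite mul0r; case: ifP => _; rewrite ?linear0 // linearZ /= td_counit_basis a1 mulr0.
rewrite conj1g mul1r eq_sym; case: ifP => _; last by rewrite linear0.
by rewrite beta_1l scale1r td_counit_basis eqxx.
Qed.

Definition td_unit : td_module :=
  td_module_of unit_act_linear unit_act_monoid_morphism.

Definition zero_act d : 'M[k]_0 := 0.

Lemma zero_act_linear : linear zero_act.
Proof. by move=> c d1 d2; rewrite scaler0 addr0. Qed.

Lemma zero_act_monoid_morphism : monoid_morphism zero_act.
Proof. by split=> [|d1 d2]; apply/matrixP=> -[]. Qed.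

Definition td_zero : td_module :=
  td_module_of zero_act_linear zero_act_monoid_morphism.

Definition dsum_act M N d : 'M[k]_(td_dim M + td_dim N) :=
  block_mx (M d) 0 0 (N d).

Lemma dsum_act_linear M N : linear (dsum_act M N).
Proof.
move=> c d1 d2; rewrite /dsum_act !linearP /= scale_block_mx add_block_mx.
by rewrite !scaler0 !addr0.
Qed.

Lemma dsum_act_monoid_morphism M N : monoid_morphism (dsum_act M N).
Proof.
split=> [|d1 d2]; first by rewrite /dsum_act !td_act1 -scalar_mx_block.
rewrite /dsum_act !td_actM [RHS]mulmx_block.
by rewrite !mul0mx !mulmx0 !addr0 !add0r.
Qed.

Definition td_dsum M N : td_module :=
  td_module_of (dsum_act_linear M N) (dsum_act_monoid_morphism M N).

(* The left dual: (d f)(v) = f (S(d) v). *)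
Definition dual_act M d : 'M[k]_(td_dim M) := (M (td_antipode d))^T.

Lemma dual_act_linear M : linear (dual_act M).
Proof. by move=> c d1 d2; rewrite /dual_act !linearP. Qed.

Lemma dual_act_monoid_morphism M : monoid_morphism (dual_act M).
Proof.
split=> [|d1 d2]; first by rewrite /dual_act td_antipode1 td_act1 trmx1.
by rewrite /dual_act td_antipodeM td_actM trmx_mul.
Qed.

Definition td_dual M : td_module :=
  td_module_of (dual_act_linear M) (dual_act_monoid_morphism M).

Definition tens_act M N d : 'M[k]_(td_dim M * td_dim N) :=
  \sum_(v : (gT * gT) * (gT * gT))
    td_comul d v *: (M (basis v.1.1 v.1.2) *t N (basis v.2.1 v.2.2)).

Lemma tens_act_linear M N : linear (tens_act M N).
Proof.
move=> c d1 d2; rewrite /tens_act scaler_sumr -big_split /=.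
apply: eq_bigr => v _; rewrite scalerA -scalerDl; congr (_ *: _).
rewrite !ffunE; case: ifP => _; rewrite ?ffunE ?mulr0 ?addr0 //. by rewrite mulrDl -mulrA.
Qed.

HB.instance Definition _ M N := GRing.isLinear.Build k D _ _ (tens_act M N)
  (@tens_act_linear M N).

Lemma tens_act_basis M N a x : tens_act M N (basis a x) =
  \sum_(b : gT) gamma x b (b^-1 * a)%g *:
    (M (basis b x) *t N (basis (b^-1 * a)%g x)).
Proof.
transitivity (\sum_b \sum_y \sum_(q : gT * gT)
    td_comul (basis a x) ((b, y), q) *: (M (basis b y) *t N (basis q.1 q.2))).
  by rewrite !pair_bigA; apply: eq_bigr => -[[b y] q].
apply: eq_bigr => b _; rewrite (bigD1 x) //= [X in _ + X]big1 ?addr0; last first.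
  move=> y /negPf yx; apply: big1 => q _.
  by rewrite !ffunE /= xpair_eqE yx andbF mul0r if_same scale0r.
rewrite (bigD1 (b^-1 * a, x)%g) //= big1 ?addr0; last first.
  move=> [c y]; rewrite !ffunE /= !xpair_eqE eqxx andbT => cy.
  case: eqVneq => [xy | _]; last by rewrite scale0r.
  rewrite -(inj_eq (mulgI b^-1%g)) mulKg.
  by move: cy; rewrite -xy eqxx andbT => /negPf->; rewrite mul0r scale0r.
by rewrite !ffunE /= eqxx mulKVg eqxx mul1r.
Qed.

Lemma tens_act_monoid_morphism M N : monoid_morphism (tens_act M N).
Proof.
apply: td_monoid_morphism => [|a x a' y].
  under eq_bigr do rewrite /= tens_act_basis.
  rewrite exchange_big /= -tensmx_11 -!td_act_sum1 tensmx_suml.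
  apply: eq_bigr => b _; rewrite tensmx_sumr (reindex_inj (mulgI b)) /=.
  by apply: eq_bigr => a _; rewrite mulKg gamma_1 scale1r.
rewrite /= !tens_act_basis td_basisMJ.
have tE b b' : (M (basis b x) *t N (basis (b^-1 * a) x)) *m
    (M (basis b' y) *t N (basis (b'^-1 * a') y)) =
  if (b ^ x == b')%g && (a ^ x == a')%g then
    (beta b x y * beta (b^-1 * a)%g x y) *:
      (M (basis b (x * y)) *t N (basis (b^-1 * a) (x * y)))
  else 0.
  rewrite tensmx_mul -!td_actM !td_basisMJ.
  case: eqVneq => [<- | _] /=; last by rewrite linear0 tens0mx.
  rewrite conjMg conjVg (inj_eq (mulgI _)).
  case: eqVneq => _; last by rewrite linear0 tensmx0.
  by rewrite !linearZ /= tensmxZZ.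
rewrite mulmx_suml; case: eqVneq tE => [<- | aa'] tE; last first.
  rewrite linear0 big1 // => b _; rewrite -scalemxAl mulmx_sumr big1 ?scaler0 //.
  by move=> b' _; rewrite -scalemxAr tE andbF scaler0.
rewrite linearZ /= tens_act_basis scaler_sumr; apply: eq_bigr => b _.
rewrite -scalemxAl mulmx_sumr (bigD1 (b ^ x)%g) //= big1 ?addr0; last first.
  by move=> b' /negPf bb'; rewrite -scalemxAr tE eq_sym bb' scaler0.
rewrite -scalemxAr tE !eqxx /= !scalerA; congr (_ *: _).
have := beta_gamma w b (b^-1 * a)%g x y.
by rewrite mulKVg conjMg conjVg => <-; rewrite !mulrA.
Qed.

Definition td_tens M N : td_module :=
  td_module_of (tens_act_linear M N) (@tens_act_monoid_morphism M N).

(* A full subcategory is given by its class of objects. The associator, the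
   braiding and the (co)evaluations do not enter the closure conditions; closure
   under the empty direct sum is [fsub_zero]. *)
Record fusion_subcategory := FusionSubcategory {
  fsub :> td_module -> Prop;
  fsub_iso : forall M N, td_iso M N -> fsub M -> fsub N;
  fsub_unit : fsub td_unit;
  fsub_zero : fsub td_zero;
  fsub_dsum : forall M N, fsub M -> fsub N -> fsub (td_dsum M N);
  fsub_summand : forall M N, fsub (td_dsum M N) -> fsub M;
  fsub_tens : forall M N, fsub M -> fsub N -> fsub (td_tens M N);
  fsub_dual : forall M, fsub M -> fsub (td_dual M) }.

Section Bicharacters.
Variables (K H : {group gT}) (B : subg_of K -> subg_of H -> k).

Definition omega_bicharacter : Prop :=
  [/\ forall (x : subg_of K) (y : subg_of H), B x y != 0,
      forall (x : subg_of K) (y z : subg_of H), B x (y * z)%g =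
        (beta (sgval x) (sgval y) (sgval z))^-1 * B x y * B x z
    & forall (v x : subg_of K) (y : subg_of H), B (v * x)%g y =
        beta (sgval y) (sgval v) (sgval x) * B v y * B x y].

(* For K and H normal, [subg K] and [subg H] are applied below to elements of K
   and H. *)
Definition G_invariant : Prop :=
  forall (x : gT) (s : subg_of K) (t : subg_of H),
  let l := sgval s in let h := sgval t in
  B (subg K (x^-1 * l * x)%g) t =
    beta l x h * beta l (x * h)%g x^-1%g / beta l x x^-1%g *
    B s (subg H (x * h * x^-1)%g).

End Bicharacters.

Record bicharacter_triple := BicharacterTriple {
  bt_K : {group gT};
  bt_H : {group gT};
  bt_B : subg_of bt_K -> subg_of bt_H -> k;
  bt_normalK : (bt_K <| [set: gT])%g;
  bt_normalH : (bt_H <| [set: gT])%g;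
  bt_cent : (bt_H \subset 'C(bt_K))%g;
  bt_bicharacter : omega_bicharacter bt_B;
  bt_invariant : G_invariant bt_B }.

End QuasiHopf.

(* Main.v *)
From HB Require Import structures.
Require Import Defs.
From mathcomp Require Import all_boot all_order all_algebra all_fingroup.
From mathcomp Require Import mxtens ring boolp.

Set Implicit Arguments.
Unset Strict Implicit.
Unset Printing Implicit Defensive.

Import GRing.Theory.
Local Open Scope group_scope.
Local Open Scope ring_scope.

(** A triple (K, H, B) gives the modules M with M(delta_a 1) = 0 for a outside K
    and M(delta_a h) = B(a, h) M(delta_a 1) for a in K and h in H. They are the
    modules on which the central idempotent
    |H|^-1 sum_(a in K, h in H) B(a, h)^-1 delta_a h acts as 1. The idempotent
    belongs to the class as a summand of the regular module, so the class
    determines it, and hence the triple.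

    Conversely, the matrix coefficients of a fusion subcategory form a space of
    functions on G x G which is graded by the first argument, invariant under
    translations of the second one, and closed under a pointwise product twisted
    by gamma. Its part of degree 1 is an algebra of functions invariant under
    translations, thus the functions on G/H for a normal subgroup H. K is the set
    of degrees that occur. Multiplying coefficients of degrees a and a^-1 shows
    that on H those of degree a are the multiples of a single nowhere zero
    function B(a, .); invariance under translations and products give the
    bicharacter identities. Averaging over G makes modules semisimple, hence a
    module lies in the subcategory as soon as its coefficients do. *)

(** * Modules cut out by idempotents, and direct summands *)

Section Retracts.
Variables (gT : finGroupType) (k : fieldType) (w : normalized_cocycle3 gT k).
Local Notation D := (twisted_double w).
Local Notation basis := (td_basis w).
Local Notation beta := (beta w).
Implicit Types (a b x y : gT) (d : D) (L M N : td_module w).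

Lemma td_hom_basis M N (f : 'M[k]_(td_dim N, td_dim M)) :
  (forall a x, f *m M (basis a x) = N (basis a x) *m f) -> td_hom f.
Proof.
move=> fE d; rewrite (td_decomp d) !linear_sum [RHS]mulmx_suml.
by apply: eq_bigr => u _; rewrite !linearZ /= fE -scalemxAl.
Qed.

Lemma td_homM L M N (f : 'M[k]_(td_dim N, td_dim M))
    (g : 'M[k]_(td_dim M, td_dim L)) :
  td_hom f -> td_hom g -> td_hom (f *m g).
Proof. by move=> hf hg d; rewrite -mulmxA hg !mulmxA hf. Qed.

Section RetractModule.
Variables (N : td_module w) (m : nat).
Variables (p : 'M[k]_(m, td_dim N)) (i : 'M[k]_(td_dim N, m)).
Hypotheses (pi1 : p *m i = 1%:M) (hom_ip : @td_hom gT k w N N (i *m p)).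

(** The action carried by the image of the idempotent endomorphism [i *m p] of [N]. *)
Definition retract_act d : 'M[k]_m := p *m N d *m i.

Lemma retract_act_linear : linear retract_act.
Proof.
by move=> c d1 d2; rewrite /retract_act linearP mulmxDr mulmxDl -scalemxAr -scalemxAl.
Qed.

Lemma retract_act_monoid_morphism : monoid_morphism retract_act.
Proof.
split=> [|d1 d2]; first by rewrite /retract_act td_act1 mulmx1.
rewrite /retract_act td_actM /GRing.mul /= !mulmxA.
by rewrite -[_ *m i *m p]mulmxA -[_ *m (i *m p)]mulmxA -hom_ip !mulmxA pi1 mul1mx.
Qed.

Definition td_retract : td_module w :=
  td_module_of retract_act_linear retract_act_monoid_morphism.

Lemma td_retract_projection : @td_hom gT k w N td_retract p.
Proof.
move=> d; rewrite /= /retract_act -!mulmxA -hom_ip !mulmxA pi1.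
by rewrite mul1mx.
Qed.

Lemma td_retract_injection : @td_hom gT k w td_retract N i.
Proof.
by move=> d; rewrite /= /retract_act !mulmxA hom_ip -!mulmxA pi1 mulmx1.
Qed.

End RetractModule.

(** In q q = q, cancel the left invertible factor [col_base q] and the right invertible factor
    [row_base q]. *)
Lemma idempotent_baseK n (q : 'M[k]_n) :
  q *m q = q -> row_base q *m col_base q = 1%:M.
Proof.
(* The factors are generalized because their types mention [q] through its rank. *)
suffices gen r (C : 'M[k]_(n, r)) R C' R' : C' *m C = 1%:M -> R *m R' = 1%:M ->
    (C *m R) *m (C *m R) = C *m R -> R *m C = 1%:M.
  move=> qq; apply: gen (mulVpmx (col_base_full q)) (mulmxVp (row_base_free q)) _.
  by rewrite !mulmx_base.
move=> CK RK /(congr1 (fun A => C' *m A *m R')).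
by rewrite -!mulmxA RK mulmx1 !mulmxA CK !mul1mx.
Qed.

Lemma row_base_idem n (q : 'M[k]_n) : q *m q = q -> row_base q *m q = row_base q.
Proof.
by move=> /idempotent_baseK RC; rewrite -[X in _ *m X]mulmx_base mulmxA RC mul1mx.
Qed.

Lemma col_base_idem n (q : 'M[k]_n) : q *m q = q -> q *m col_base q = col_base q.
Proof.
by move=> /idempotent_baseK RC; rewrite -[X in X *m _]mulmx_base -mulmxA RC mulmx1.
Qed.

(** This transports an action on the image of [q] back to the whole space, where faithfulness of the
    regular module applies. *)
Lemma base_sandwich n (q A : 'M[k]_n) :
  col_base q *m (row_base q *m A *m col_base q) *m row_base q = q *m A *m q.
Proof.
suffices gen r (C : 'M[k]_(n, r)) R :
    C *m (R *m A *m C) *m R = (C *m R) *m A *m (C *m R) by rewrite gen mulmx_base.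
by rewrite !mulmxA.
Qed.

(* The complement of M in N is cut out by the idempotent 1 - i p. *)
Lemma td_retract_dsum M N (p : 'M[k]_(td_dim M, td_dim N))
    (i : 'M[k]_(td_dim N, td_dim M)) :
    td_hom p -> td_hom i -> p *m i = 1%:M ->
  exists L, td_iso N (td_dsum M L).
Proof.
move=> hp hi pi1; set q := 1%:M - i *m p.
have qq : q *m q = q.
  rewrite {2}/q mulmxBr mulmx1 /q mulmxBl mul1mx.
  by rewrite -!mulmxA (mulmxA p) pi1 mul1mx subrr subr0.
have hq : @td_hom gT k w N N (col_base q *m row_base q).
  move=> d; rewrite mulmx_base /q mulmxBl mulmxBr mul1mx mulmx1.
  by congr (_ - _); apply: td_homM.
have RC := idempotent_baseK qq.
have pq : p *m q = 0 by rewrite /q mulmxBr mulmx1 mulmxA pi1 mul1mx subrr.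
have qi : q *m i = 0 by rewrite /q mulmxBl mul1mx -mulmxA pi1 mulmx1 subrr.
have pC : p *m col_base q = 0.
  by rewrite -(col_base_idem qq) mulmxA pq mul0mx.
have Ri : row_base q *m i = 0.
  by rewrite -(row_base_idem qq) -mulmxA qi mulmx0.
exists (td_retract RC hq).
exists (col_mx p (row_base q)), (row_mx i (col_base q)); split.
- move=> d; rewrite mul_col_mx mul_block_col !mul0mx addr0 add0r hp.
  by rewrite (td_retract_projection RC hq).
- move=> d; rewrite mul_mx_row mul_row_block !mulmx0 addr0 add0r hi.
  by rewrite (td_retract_injection RC hq).
- by rewrite mul_row_col mulmx_base addrC subrK.
- by rewrite mul_col_row pi1 RC pC Ri -scalar_mx_block.
Qed.

End Retracts.

(** * Averaging linear maps into module maps *)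

Section Averaging.
Variables (gT : finGroupType) (k : fieldType) (w : normalized_cocycle3 gT k).
Hypothesis card_neq0 : (#|gT|%:R : k) != 0.
Local Notation D := (twisted_double w).
Local Notation basis := (td_basis w).
Local Notation beta := (beta w).
Implicit Types (a b x y : gT) (d : D) (L M N : td_module w).

(* |G|^-1 sum_(a, x) beta_a(x, x^-1)^-1 delta_a x (x) delta_(a ^ x) x^-1 is the
   separability idempotent of the twisted double. *)
Definition average M N (f : 'M[k]_(td_dim N, td_dim M)) :=
  (#|gT|%:R)^-1 *: \sum_a \sum_x (beta a x x^-1%g)^-1 *:
    (N (basis a x) *m f *m M (basis (a ^ x) x^-1)%g).

(** Acting by delta_b y on the right leaves only the terms a = b, on the left only a = b ^ y; the
    substitution x -> y x matches the two. *)
Lemma average_hom M N (f : 'M[k]_(td_dim N, td_dim M)) : td_hom (average f).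
Proof.
apply: td_hom_basis => b y; rewrite /average -scalemxAl -scalemxAr; congr (_ *: _).
rewrite !mulmx_suml mulmx_sumr.
transitivity (\sum_x ((beta b x x^-1%g)^-1 * beta (b ^ x)%g x^-1%g y) *:
    (N (basis b x) *m f *m M (basis (b ^ x) (x^-1 * y))%g)).
  rewrite (bigD1 b) //= [X in _ + X]big1 ?addr0 => [|a ab]; last first.
    rewrite mulmx_suml big1 // => x _; rewrite -scalemxAl -mulmxA -td_actM.
    by rewrite td_basisMJ conjgK (negPf ab) linear0 mulmx0 scaler0.
  rewrite mulmx_suml; apply: eq_bigr => x _.
  rewrite -scalemxAl -mulmxA -td_actM td_basisMJ conjgK eqxx linearZ /=.
  by rewrite -scalemxAr scalerA.
rewrite [RHS](bigD1 (b ^ y)%g) //= [X in _ + X]big1 ?addr0 => [|a ab]; last first.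
  rewrite mulmx_sumr big1 // => x _; rewrite -scalemxAr !mulmxA -td_actM.
  by rewrite td_basisMJ eq_sym (negPf ab) linear0 !mul0mx scaler0.
rewrite mulmx_sumr (reindex_inj (mulgI y)) /=; apply: eq_bigr => x _.
rewrite -scalemxAr !mulmxA -td_actM td_basisMJ eqxx linearZ /= -!scalemxAl scalerA.
rewrite invMg mulgKV conjgM; congr (_ *: _).
have e1 := beta_cocycle w b (y * x)%g (x^-1 * y^-1)%g y.
have e2 := beta_cocycle w b y x x^-1%g.
rewrite mulgV mulgKV !beta_1r -invMg mulgV beta_1 invMg conjgM !mulr1 in e1 e2.
rewrite e1 -e2; field.
by rewrite !beta_neq0.
Qed.

(** The coefficients in [average] cancel the [beta] of the product of delta_a x and delta_(a ^ x)
    x^-1, leaving |G| copies of the sum of the delta_a 1. *)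
Lemma average1 M : @average M M 1%:M = 1%:M.
Proof.
rewrite /average exchange_big /= -[RHS]td_act_sum1.
transitivity ((#|gT|%:R : k)^-1 *: \sum_(x : gT) \sum_a M (basis a 1%g)).
  congr (_ *: _); apply: eq_bigr => x _; apply: eq_bigr => a _.
  rewrite mulmx1 -td_actM td_basisMJ eqxx linearZ /= scalerA.
  by rewrite mulgV mulVf ?scale1r ?beta_neq0.
by rewrite sumr_const -scaler_nat scalerA mulVf // scale1r.
Qed.

Lemma average_mull L M N (f : 'M[k]_(td_dim L, td_dim N))
    (g : 'M[k]_(td_dim N, td_dim M)) :
  td_hom f -> f *m average g = average (f *m g).
Proof.
move=> hf; rewrite /average -scalemxAr mulmx_sumr; congr (_ *: _).
apply: eq_bigr => a _; rewrite mulmx_sumr; apply: eq_bigr => x _.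
by rewrite -scalemxAr !mulmxA hf.
Qed.

End Averaging.

(** * Matrix coefficients of a fusion subcategory *)

Lemma tensmx_entry (k : fieldType) m n (r : 'rV[k]_m) (A : 'M[k]_m)
    (c : 'cV[k]_m) (s : 'rV[k]_n) (B : 'M[k]_n) (d : 'cV[k]_n) (i : 'I_(1 * 1)) :
  ((r *t s) *m (A *t B) *m (c *t d)) i i =
  (r *m A *m c) 0 0 * (s *m B *m d) 0 0.
Proof. by rewrite !tensmx_mul mxE !ord1. Qed.

Section Coefficients.
Variables (gT : finGroupType) (k : fieldType) (w : normalized_cocycle3 gT k).
Variable F : fusion_subcategory w.
Local Notation basis := (td_basis w).
Local Notation beta := (beta w).
Local Notation gamma := (gamma w).
Implicit Types (a b x y : gT) (M N : td_module w) (f g : gT -> gT -> k).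
Implicit Types phi psi : gT -> k.

(** Arbitrary row and column vectors, instead of matrix entries, make sums and translates again
    coefficients of a single object. *)
Definition fsub_coef f : Prop :=
  exists M (r : 'rV_(td_dim M)) (c : 'cV_(td_dim M)),
    F M /\ forall a x, (r *m M (basis a x) *m c) 0 0 = f a x.

Lemma fsub_coef_entry M i j : F M -> fsub_coef (fun a x => M (basis a x) i j).
Proof.
move=> FM; exists M, (delta_mx 0 i), (delta_mx j 0); split=> // a x.
by rewrite -rowE -colE !mxE.
Qed.

(** The identity of [M] is its own average, and the entries in that average can be computed in
    objects of [F]. Hence it factors through an object N of [F] by a module map N -> M; averaging
    the other factor makes [M] a direct summand of N. *)
Lemma fsub_of_coef M : (#|gT|%:R : k) != 0 ->
  (forall i j, fsub_coef (fun a x => M (basis a x) i j)) -> F M.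
Proof.
move=> card_neq0 coefM.
(* Here [p] is a module map, while [u] is merely linear until it is averaged at the end. *)
pose generated (A : 'M[k]_(td_dim M)) := exists N (p : 'M_(td_dim M, td_dim N))
  (u : 'M_(td_dim N, td_dim M)), [/\ F N, @td_hom gT k w N M p & A = p *m u].
have gen0 : generated 0.
  exists (td_zero w), 0, 0; rewrite mulmx0; split=> //; first exact: fsub_zero.
  by move=> d; rewrite mul0mx mulmx0.
have genD A B : generated A -> generated B -> generated (A + B).
  case=> N1 [p1 [u1 [F1 h1 ->]]] [N2 [p2 [u2 [F2 h2 ->]]]].
  exists (td_dsum N1 N2), (row_mx p1 p2), (col_mx u1 u2).
  split; [exact: fsub_dsum | | by rewrite mul_row_col].
  by move=> d; rewrite mul_row_block !mulmx0 addr0 add0r h1 h2 mul_mx_row.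
(* The part of [average 1%:M] coming from the entry (i, j) of the second action. *)
pose T i j := (#|gT|%:R : k)^-1 *: \sum_a \sum_x (beta a x x^-1%g)^-1 *:
  (M (basis a x) *m (M (basis (a ^ x) x^-1)%g i j *: delta_mx i j)).
have genT i j : generated (T i j).
  have [N [r [c [FN fE]]]] := coefM i j.
  (* The entry is r N(.) c: [r] goes into the averaged map, [c] into the linear factor. *)
  exists N, (average (delta_mx i 0 *m r)), (c *m delta_mx 0 j).
  split=> //; first exact: average_hom.
  rewrite /average /T -scalemxAl mulmx_suml; congr (_ *: _).
  apply: eq_bigr => a _; rewrite mulmx_suml; apply: eq_bigr => x _.
  rewrite -scalemxAl -!mulmxA; congr (_ *: (_ *m _)).
  rewrite -fE !mulmxA; set z := r *m _ *m c.
  rewrite -(mulmxA _ r) -(mulmxA _ _ c) -/z [z]mx11_scalar mxE /= mulr1n.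
  by rewrite mul_mx_scalar -scalemxAl mul_delta_mx.
have: generated 1%:M.
  rewrite -(average1 card_neq0 M).
  have -> : average 1%:M = \sum_i \sum_j T i j :> 'M[k]_(td_dim M).
    rewrite /average /T; under [RHS]eq_bigr do rewrite -scaler_sumr.
    rewrite -scaler_sumr; congr (_ *: _).
    under [RHS]eq_bigr do rewrite exchange_big; rewrite [RHS]exchange_big /=.
    apply: eq_bigr => a _.
    under [RHS]eq_bigr do rewrite exchange_big; rewrite [RHS]exchange_big /=.
    apply: eq_bigr => x _.
    under [RHS]eq_bigr do rewrite -scaler_sumr -mulmx_sumr.
    by rewrite -scaler_sumr -mulmx_sumr mulmx1 -matrix_sum_delta.
  by apply: (big_ind generated) => // i _; apply: (big_ind generated).
case=> N [p [u [FN hp pu]]].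
have pu1 : p *m average u = 1%:M by rewrite average_mull // -pu average1.
have [L NML] := td_retract_dsum hp (average_hom u) pu1.
exact: fsub_summand (fsub_iso NML FN).
Qed.

Lemma eq_fsub_coef f g : f =2 g -> fsub_coef f -> fsub_coef g.
Proof. by move=> fg [M [r [c [FM fE]]]]; exists M, r, c; split=> // a x; rewrite fE fg. Qed.

Lemma fsub_coefD f g :
  fsub_coef f -> fsub_coef g -> fsub_coef (fun a x => f a x + g a x).
Proof.
case=> [M [r [c [FM fE]]]] [N [s [d [FN gE]]]].
exists (td_dsum M N), (row_mx r s), (col_mx c d); split; first exact: fsub_dsum.
move=> a x; rewrite mul_row_block !mulmx0 addr0 add0r mul_row_col.
by rewrite mxE fE gE.
Qed.

Lemma fsub_coefZ t f : fsub_coef f -> fsub_coef (fun a x => t * f a x).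
Proof.
case=> [M [r [c [FM fE]]]]; exists M, (t *: r), c; split=> // a x.
by rewrite -!scalemxAl mxE fE.
Qed.

Lemma fsub_coef_unit : fsub_coef (fun a x => (a == 1%g)%:R).
Proof.
exists (td_unit w), 1%:M, 1%:M; split=> [|a x]; first exact: fsub_unit.
by rewrite mul1mx mulmx1 /= /unit_act mxE mulr1n td_counit_basis.
Qed.

Lemma fsub_coef0 : fsub_coef (fun a x => 0).
Proof.
by apply: eq_fsub_coef (fsub_coefZ 0 fsub_coef_unit) => a x; rewrite mul0r.
Qed.

Lemma fsub_coef_sum (I : finType) (f : I -> gT -> gT -> k) :
  (forall i, fsub_coef (f i)) -> fsub_coef (fun a x => \sum_i f i a x).
Proof.
move=> cf; suff cr (s : seq I) : fsub_coef (fun a x => \sum_(i <- s) f i a x) by [].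
elim: s => [|i s IHs].
  by apply: eq_fsub_coef fsub_coef0 => a x; rewrite big_nil.
by apply: eq_fsub_coef (fsub_coefD (cf i) IHs) => a x; rewrite big_cons.
Qed.

(** The functional d |-> f (delta_b y d): delta_b y is absorbed into the row vector. *)
Lemma fsub_coef_mull f b y : fsub_coef f ->
  fsub_coef (fun a x => if (b ^ y)%g == a then beta b y x * f b (y * x)%g else 0).
Proof.
case=> [M [r [c [FM fE]]]]; exists M, (r *m M (basis b y)), c; split=> // a x.
rewrite -(mulmxA r) -td_actM td_basisMJ; case: ifP => _.
  by rewrite linearZ /= -scalemxAr -scalemxAl mxE fE.
by rewrite linear0 mulmx0 mul0mx mxE.
Qed.

Lemma fsub_coef_mulr f b y : fsub_coef f ->
  fsub_coef (fun a x => if (a ^ x)%g == b then beta a x y * f a (x * y)%g else 0).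
Proof.
case=> [M [r [c [FM fE]]]]; exists M, r, (M (basis b y) *m c); split=> // a x.
rewrite mulmxA -(mulmxA r) -td_actM td_basisMJ; case: ifP => _.
  by rewrite linearZ /= -scalemxAr -scalemxAl mxE fE.
by rewrite linear0 mulmx0 mul0mx mxE.
Qed.

(** The product dual to the coproduct, realized on tensor products. *)
Lemma fsub_coefM f g : fsub_coef f -> fsub_coef g -> fsub_coef
  (fun a x => \sum_b gamma x b (b^-1 * a)%g * (f b x * g (b^-1 * a)%g x)).
Proof.
case=> [M [r [c [FM fE]]]] [N [s [d [FN gE]]]].
exists (td_tens M N), (r *t s), (c *t d); split; first exact: fsub_tens.
move=> a x; rewrite [td_tens M N _]tens_act_basis mulmx_sumr mulmx_suml summxE.
apply: eq_bigr => b _; rewrite -scalemxAr -scalemxAl mxE; congr (_ * _).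
by rewrite -fE -gE; apply: tensmx_entry.
Qed.

Definition graded_coef a phi : Prop :=
  fsub_coef (fun b x => if b == a then phi x else 0).

Lemma eq_graded_coef a phi psi :
  phi =1 psi -> graded_coef a phi -> graded_coef a psi.
Proof. by move=> e; apply: eq_fsub_coef => b x; rewrite e. Qed.

Lemma graded_component f a : fsub_coef f -> graded_coef a (f a).
Proof.
move=> /(fsub_coef_mull a 1%g); apply: eq_fsub_coef => b x.
by rewrite conjg1 eq_sym beta_1 mul1r mul1g.
Qed.

Lemma graded_coefD a phi psi : graded_coef a phi -> graded_coef a psi ->
  graded_coef a (fun x => phi x + psi x).
Proof.
move=> p q; apply: eq_fsub_coef (fsub_coefD p q) => b x.
by case: ifP; rewrite ?addr0.
Qed.

Lemma graded_coefZ a t phi : graded_coef a phi -> graded_coef a (fun x => t * phi x).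
Proof.
move=> p; apply: eq_fsub_coef (fsub_coefZ t p) => b x.
by case: ifP; rewrite ?mulr0.
Qed.

Lemma graded_coef1 : graded_coef 1%g (fun=> 1).
Proof. by apply: eq_fsub_coef fsub_coef_unit => a x; case: eqP. Qed.

Lemma graded_coef_left a phi y : graded_coef a phi ->
  graded_coef (a ^ y)%g (fun x => beta a y x * phi (y * x)%g).
Proof.
move=> /(fsub_coef_mull a y); apply: eq_fsub_coef => b x.
by rewrite eqxx eq_sym.
Qed.

(** Right multiplication by delta_b 1 keeps the points x with a ^ x = b. This later forces the two
    subgroups to commute. *)
Lemma graded_coef_conj a phi b : graded_coef a phi ->
  graded_coef a (fun x => if (a ^ x)%g == b then phi x else 0).
Proof.
move=> /(fsub_coef_mulr b 1%g); apply: eq_fsub_coef => c x.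
by have [->|] := eqVneq c a; rewrite ?beta_1r ?mul1r ?mulg1 ?mulr0 ?if_same.
Qed.

(** Right multiplication by delta_b y only sees the x with a ^ x = b; the sum over b lifts this
    restriction. *)
Lemma graded_coef_right a phi y : graded_coef a phi ->
  graded_coef a (fun x => beta a x y * phi (x * y)%g).
Proof.
move=> p; apply: eq_fsub_coef (fsub_coef_sum (fun b => fsub_coef_mulr b y p)) => c x.
rewrite (bigD1 (c ^ x)%g) //= eqxx big1 ?addr0 => [|b /negPf cb].
  by have [->|] := eqVneq c a; rewrite ?mulr0.
by rewrite eq_sym cb.
Qed.

Lemma graded_coefM a b phi psi : graded_coef a phi -> graded_coef b psi ->
  graded_coef (a * b)%g (fun x => gamma x a b * (phi x * psi x)).
Proof.
move=> p q; apply: eq_fsub_coef (fsub_coefM p q) => c x.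
rewrite (bigD1 a) //= eqxx big1 ?addr0 => [|d /negPf->].
  rewrite -[(a^-1 * c)%g == b](inj_eq (mulgI a)) mulKVg.
  by have [->|] := eqVneq c; rewrite ?mulKg ?mulr0.
by rewrite mul0r mulr0.
Qed.

End Coefficients.

(** * The fusion subcategory of a triple and its central idempotent *)

Section TotalBicharacter.
Variables (gT : finGroupType) (k : fieldType) (w : normalized_cocycle3 gT k).
Local Notation D := (twisted_double w).
Local Notation basis := (td_basis w).
Local Notation beta := (beta w).
Local Notation gamma := (gamma w).

(* Invariant bicharacters as functions on G x G, whose values outside K x H are
   junk. *)
Record bicharacter_on (K H : {group gT}) (b : gT -> gT -> k) : Prop :=
  BicharacterOn {
  bion_normalK : (K <| [set: gT])%g;
  bion_normalH : (H <| [set: gT])%g;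
  bion_cent : (H \subset 'C(K))%g;
  bion_neq0 : forall x y, x \in K -> y \in H -> b x y != 0;
  bion_mulr : forall x y z, x \in K -> y \in H -> z \in H ->
    b x (y * z)%g = (beta x y z)^-1 * b x y * b x z;
  bion_mull : forall v x y, v \in K -> x \in K -> y \in H ->
    b (v * x)%g y = beta y v x * b v y * b x y;
  bion_conj : forall x l h, l \in K -> h \in H ->
    b (l ^ x)%g h = beta l x h * beta l (x * h)%g x^-1%g / beta l x x^-1%g *
    b l (h ^ x^-1)%g }.

Variables (K H : {group gT}) (b : gT -> gT -> k).
Hypothesis bichar : bicharacter_on K H b.
Implicit Types (a x y z h : gT) (d : D) (M N : td_module w).

Lemma bion_conjg a h : a \in K -> h \in H -> (a ^ h)%g = a.
Proof.
move=> aK hH; apply/conjg_fixP/commgP; apply: commute_sym.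
exact: (centsP (bion_cent bichar)).
Qed.

Lemma bion_memJK a x : ((a ^ x)%g \in K) = (a \in K).
Proof. by rewrite memJ_norm // (subsetP (normal_norm (bion_normalK bichar))) ?inE. Qed.

Lemma bion_memJH a x : ((a ^ x)%g \in H) = (a \in H).
Proof. by rewrite memJ_norm // (subsetP (normal_norm (bion_normalH bichar))) ?inE. Qed.

Lemma bion_1r a : a \in K -> b a 1%g = 1.
Proof.
move=> aK; have := bion_mulr bichar aK (group1 H) (group1 H).
rewrite mulg1 beta_1 invr1 mul1r => e.
by apply: (mulfI (bion_neq0 bichar aK (group1 H))); rewrite mulr1.
Qed.

Lemma bion_1l h : h \in H -> b 1%g h = 1.
Proof.
move=> hH; have := bion_mull bichar (group1 K) (group1 K) hH.
rewrite mulg1 beta_1 mul1r => e.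
by apply: (mulfI (bion_neq0 bichar (group1 K) hH)); rewrite mulr1.
Qed.

Lemma conjg_fixC x y : (x ^ y)%g = x -> (y ^ x)%g = y.
Proof.
by move=> xy; apply/conjg_fixP/commgP/commute_sym/commgP/conjg_fixP.
Qed.

(** When h commutes with x and a, both cochains are the same quotient of values of [w]. This ties
    the coproduct to [bion_mull]. *)
Lemma gamma_beta x a h : (x ^ h)%g = x -> (a ^ h)%g = a -> gamma h x a = beta h x a.
Proof.
move=> xh ah; have hx := conjg_fixC xh; have ha := conjg_fixC ah.
by rewrite gammaE betaE conjgM xh ah hx ha [w x a h * _]mulrC.
Qed.

Definition bicharacter_class M : Prop :=
  (forall a, a \notin K -> M (basis a 1%g) = 0) /\
  (forall a h, a \in K -> h \in H -> M (basis a h) = b a h *: M (basis a 1%g)).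

Lemma td_basis1M a x : basis a 1%g * basis a x = basis a x.
Proof. by rewrite td_basisMJ conjg1 eqxx beta_1 scale1r mul1g. Qed.

Lemma bicharacter_class_out M a x :
  bicharacter_class M -> a \notin K -> M (basis a x) = 0.
Proof. by case=> M0 _ aK; rewrite -td_basis1M td_actM M0 // mul0mx. Qed.

Lemma bicharacter_class_iso M N :
  td_iso M N -> bicharacter_class M -> bicharacter_class N.
Proof.
case=> f [g [hf hg _ fg1]] [M0 MB].
have NE d : N d = f *m M d *m g by rewrite hf -mulmxA fg1 mulmx1.
split=> [a aK | a h aK hH]; first by rewrite NE M0 // mulmx0 mul0mx.
by rewrite !NE MB // -scalemxAr -scalemxAl.
Qed.

Lemma bicharacter_class_unit : bicharacter_class (td_unit w).
Proof.
split=> [a aK | a h aK hH]; rewrite /= /unit_act !td_counit_basis.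
  by case: eqP aK => [->|_ _]; rewrite ?group1 // raddf0.
by have [->|_] := eqVneq a 1%g; rewrite ?bion_1l ?scale1r // raddf0 scaler0.
Qed.

Lemma bicharacter_class_zero : bicharacter_class (td_zero w).
Proof. by split=> *; apply/matrixP=> -[]. Qed.

Lemma bicharacter_class_dsum M N :
  bicharacter_class M -> bicharacter_class N -> bicharacter_class (td_dsum M N).
Proof.
move=> [M0 MB] [N0 NB]; split=> [a aK | a h aK hH]; rewrite /= /dsum_act.
  by rewrite M0 ?N0 // block_mx0.
by rewrite (MB a h aK hH) (NB a h aK hH) [RHS]scale_block_mx !scaler0.
Qed.

Lemma bicharacter_class_summand M N :
  bicharacter_class (td_dsum M N) -> bicharacter_class M.
Proof.
move=> [M0 MB]; split=> [a aK | a h aK hH].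
  by have /eqP := M0 a aK; rewrite block_mx_eq0 => /and4P[/eqP].
by have := MB a h aK hH; rewrite [RHS]scale_block_mx => /eq_block_mx[].
Qed.

(** In the coproduct of delta_a h the coefficient [gamma] becomes a [beta], which [bion_mull]
    absorbs for a = c (c^-1 a). *)
Lemma bicharacter_class_tens M N :
  bicharacter_class M -> bicharacter_class N -> bicharacter_class (td_tens M N).
Proof.
move=> cM cN; split=> [a aK | a h aK hH].
  rewrite [LHS]tens_act_basis big1 // => c _.
  have [cK | cK] := boolP (c \in K); last first.
    by rewrite (bicharacter_class_out _ cM) // tens0mx scaler0.
  by rewrite (bicharacter_class_out _ cN) ?tensmx0 ?scaler0 // groupMl ?groupV.
rewrite [LHS]tens_act_basis [td_tens M N _]tens_act_basis scaler_sumr.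
apply: eq_bigr => c _; have [cK | cK] := boolP (c \in K); last first.
  by rewrite !(bicharacter_class_out _ cM) // !tens0mx !scaler0.
have dK : (c^-1 * a)%g \in K by rewrite groupMl ?groupV.
case: (cM) (cN) => _ -> // [_ ->] //; rewrite tensmxZZ !scalerA gamma_1 mulr1.
congr (_ *: _); rewrite gamma_beta ?bion_conjg //.
by rewrite mulrA -(bion_mull bichar) // mulKVg.
Qed.

Lemma bicharacter_class_dual M :
  bicharacter_class M -> bicharacter_class (td_dual M).
Proof.
move=> [M0 MB]; split=> [a aK | a h aK hH]; rewrite /= /dual_act !td_antipode_basis.
  by rewrite invg1 conjg1 linearZ /= M0 ?groupV // scaler0 linear0.
have VK : a^-1%g \in K by rewrite groupV.
have VH : h^-1%g \in H by rewrite groupV.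
rewrite invg1 conjg1 beta_1 gamma_1 mulr1 invr1 scale1r.
rewrite linearZ /= bion_conjg // MB // scalerA linearZ /=; congr (_ *: _).
(* Taken at h h^-1 = 1 and a a^-1 = 1, the two rules express b(a^-1, h^-1) by b(a, h), up to
   precisely the coefficient of the antipode. *)
have e1 := bion_mulr bichar VK hH VH; have e2 := bion_mull bichar aK VK hH.
rewrite mulgV bion_1r // in e1; rewrite mulgV bion_1l // in e2.
rewrite gamma_beta ?bion_conjg //.
apply: (eq_of_ratio (congr2 ( *%R) (esym e1) e2)); last field.
  by rewrite -e2 mulr1 oner_neq0.
by rewrite !beta_neq0.
Qed.

Definition bicharacter_fsub : fusion_subcategory w :=
  FusionSubcategory bicharacter_class_iso bicharacter_class_unit
    bicharacter_class_zero bicharacter_class_dsum bicharacter_class_summand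
    bicharacter_class_tens bicharacter_class_dual.

Hypothesis cardH_neq0 : (#|H|%:R : k) != 0.

Definition bicharacter_idem : D := [ffun u =>
  if (u.1 \in K) && (u.2 \in H) then (#|H|%:R * b u.1 u.2)^-1 else 0].
Local Notation p := bicharacter_idem.

Lemma td_basis_mulE a x d c z : (basis a x * d) (c, z) =
  if c == a then d (a ^ x, x^-1 * z)%g * beta a x (x^-1 * z)%g else 0.
Proof.
rewrite ffunE (bigD1 x) //= big1 ?addr0 => [|y /negPf yx]; last first.
  by rewrite ffunE xpair_eqE yx andbF !mul0r.
by rewrite ffunE xpair_eqE eqxx andbT; case: eqP => [->|_]; rewrite ?mul1r ?mul0r.
Qed.

Lemma td_mul_basisE a x d c z : (d * basis a x) (c, z) =
  if (c ^ (z * x^-1))%g == a then d (c, z * x^-1)%g * beta c (z * x^-1)%g x else 0.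
Proof.
rewrite ffunE (bigD1 (z * x^-1)%g) //= big1 ?addr0 => [|y yx]; last first.
  rewrite ffunE xpair_eqE; have [yzx|] := eqVneq (y^-1 * z)%g x; last first.
    by rewrite andbF mulr0 mul0r.
  by case/eqP: yx; rewrite -yzx invMg invgK mulKVg.
rewrite ffunE xpair_eqE invMg invgK mulgKV eqxx andbT.
by case: ifP => _; rewrite ?mulr1 ?mulr0 ?mul0r.
Qed.

(** Both products live in degree a, at the z with z y^-1 in H; there G-invariance and the cocycle
    identity for [beta] compare the coefficients. *)
Lemma bicharacter_idem_basisC a y : p * basis a y = basis a y * p.
Proof.
apply/ffunP=> -[c z]; rewrite td_basis_mulE td_mul_basisE !ffunE /= bion_memJK.
have zyE : (y^-1 * z = (z * y^-1) ^ y)%g by rewrite conjgE mulgKV.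
have -> : ((y^-1 * z)%g \in H) = ((z * y^-1)%g \in H) by rewrite zyE bion_memJH.
case: (boolP (c \in K)) => [cK | cK] /=; last first.
  by rewrite mul0r if_same; case: eqP => // <-; rewrite (negPf cK) mul0r.
case: (boolP (_ \in H)) => [hH | hH]; last by rewrite andbF !mul0r !if_same.
rewrite bion_conjg //; case: eqP => // ca; subst c; rewrite cK /=.
set h := (y^-1 * z)%g; have h'H : h \in H by rewrite /h zyE bion_memJH.
have hE : (z * y^-1 = h ^ y^-1)%g by rewrite /h zyE conjgK.
have nB := bion_neq0 bichar.
rewrite (bion_conj bichar) // -hE.
have yh : (y * h)%g = z by rewrite /h mulKVg.
have e1 := beta_cocycle w a z y^-1%g y; have e2 := beta_cocycle w a y y^-1%g y.
rewrite mulVg mulgV beta_1 !beta_1r !mulr1 in e1 e2.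
rewrite -yh conjgM (bion_conjg (a := (a ^ y)%g)) ?bion_memJK // yh -e2 in e1.
rewrite yh -e1; field.
by rewrite cardH_neq0 nB ?beta_neq0.
Qed.

Lemma bicharacter_idemC d : p * d = d * p.
Proof.
rewrite (td_decomp d) mulr_sumr mulr_suml; apply: eq_bigr => u _.
by rewrite -scalerAr -scalerAl bicharacter_idem_basisC.
Qed.

Lemma td_basis_idem_out a : a \notin K -> basis a 1%g * p = 0.
Proof.
move=> aK; apply/ffunP=> -[c z]; rewrite td_basis_mulE !ffunE conjg1 /=.
by rewrite (negPf aK) mul0r if_same.
Qed.

Lemma td_basis_idem a h :
  a \in K -> h \in H -> basis a h * p = b a h *: (basis a 1%g * p).
Proof.
move=> aK hH; apply/ffunP=> -[c z]; rewrite td_basis_mulE.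
rewrite [RHS]ffunE td_basis_mulE !ffunE conjg1 bion_conjg // invg1 mul1g aK /=.
rewrite groupMl ?groupV //; case: ifP => _; last by rewrite scaler0.
case: ifP => zH; last by rewrite !mul0r scaler0.
have hzH : (h^-1 * z)%g \in H by rewrite groupMl ?groupV.
have := bion_mulr bichar aK hH hzH; rewrite mulKVg => ->; rewrite beta_1 /GRing.scale /=.
by field; rewrite cardH_neq0 !(bion_neq0 bichar) ?beta_neq0.
Qed.

(** For a in K, each of the |H| terms of degree a contributes |H|^-1 f(delta_a 1). The target is
    arbitrary so as to cover both the action on a module and the map d |-> d p. *)
Lemma bicharacter_idem_linear (V : lmodType k) (f : {linear D -> V}) :
    (forall a, a \notin K -> f (basis a 1%g) = 0) ->
    (forall a h, a \in K -> h \in H -> f (basis a h) = b a h *: f (basis a 1%g)) ->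
  f p = f 1.
Proof.
move=> f0 fB; rewrite (td_decomp p) td_1E !linear_sum /=.
rewrite (eq_bigr (fun u => f (p (u.1, u.2) *: basis u.1 u.2))); last by case.
rewrite -(pair_bigA _ (fun a h => f (p (a, h) *: basis a h))) /=.
apply: eq_bigr => a _; have [aK | aK] := boolP (a \in K); last first.
  by rewrite f0 // big1 // => h _; rewrite ffunE /= (negPf aK) scale0r linear0.
rewrite (bigID (mem H)) /= [X in _ + X]big1 ?addr0 => [|h hH]; last first.
  by rewrite ffunE /= (negPf hH) andbF scale0r linear0.
rewrite (eq_bigr (fun=> (#|H|%:R)^-1 *: f (basis a 1%g))) => [|h hH].
  by rewrite sumr_const -scaler_nat scalerA mulfV // scale1r.
rewrite ffunE /= aK hH linearZ /= fB // scalerA invfM -mulrA mulVf ?mulr1 //.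
exact: (bion_neq0 bichar).
Qed.

(** If p acts as 1, then d acts as d p, and these products satisfy the relations of the class
    already in the algebra. *)
Lemma bicharacter_class_idem M : bicharacter_class M <-> M p = 1%:M.
Proof.
split=> [[M0 MB] | Mp].
  exact: etrans (bicharacter_idem_linear M0 MB) (td_act1 M).
have ME d : M d = M (d * p) by rewrite td_actM Mp mulmx1.
split=> [a aK | a h aK hH]; first by rewrite ME td_basis_idem_out ?linear0.
by rewrite ME td_basis_idem // linearZ /= -ME.
Qed.

Lemma bicharacter_idemM : p * p = p.
Proof.
have lp : linear (fun d => d * p) by move=> t d1 d2; rewrite mulrDl scalerAl.
pose f := HB.pack_for {linear D -> D} (fun d : D => d * p)
  (GRing.isLinear.Build k D D *:%R _ lp).
have := @bicharacter_idem_linear _ f td_basis_idem_out td_basis_idem.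
by rewrite /f /= mul1r.
Qed.

End TotalBicharacter.

(** * The left regular module *)

Section RegularModule.
Variables (gT : finGroupType) (k : fieldType) (w : normalized_cocycle3 gT k).
Local Notation D := (twisted_double w).
Implicit Types d : D.

Definition regular_act d : 'M[k]_#|{: gT * gT}| := \matrix_(i, j)
  (d * td_basis w (enum_val j).1 (enum_val j).2) (enum_val i).

Lemma regular_act_linear : linear regular_act.
Proof. by move=> c d1 d2; apply/matrixP=> i j; rewrite !mxE mulrDl -scalerAl !ffunE. Qed.

Lemma regular_act_monoid_morphism : monoid_morphism regular_act.
Proof.
split=> [|d1 d2]; apply/matrixP=> i j; rewrite !mxE.
  by rewrite mul1r ffunE -surjective_pairing (inj_eq enum_val_inj).
rewrite -mulrA; set d3 := d2 * _.
rewrite [in LHS](td_decomp d3) mulr_sumr sum_ffunE.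
rewrite (reindex (enum_val (A := {: gT * gT}))) /=; last exact: onW_bij (enum_val_bij _).
by apply: eq_bigr => l _; rewrite !mxE -scalerAr ffunE mulrC.
Qed.

Definition td_regular : td_module w :=
  td_module_of regular_act_linear regular_act_monoid_morphism.

(** An element is recovered from its products with the delta_a 1, whose sum is 1. *)
Lemma td_regular_inj : injective td_regular.
Proof.
move=> d1 d2 /matrixP e.
have eb a : d1 * td_basis w a 1%g = d2 * td_basis w a 1%g.
  apply/ffunP=> u; have := e (enum_rank u) (enum_rank (a, 1%g)).
  by rewrite !mxE !enum_rankK.
rewrite -[d1]mulr1 -[d2]mulr1 td_1E !mulr_sumr.
by apply: eq_bigr => a _.
Qed.

End RegularModule.

(** * Inclusion of classes in terms of idempotents *)

Section ClassInjective.
Variables (gT : finGroupType) (k : fieldType) (w : normalized_cocycle3 gT k).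
Hypothesis char0 : has_pchar0 k.
Implicit Types (K H : {group gT}) (b : gT -> gT -> k).

Lemma cardG_neq0 H : (#|H|%:R : k) != 0.
Proof. by rewrite ((pcharf0P k).1 char0) -lt0n cardG_gt0. Qed.

(** On the left ideal D p the central element p acts as 1, so this module is in the first class,
    hence in the second, and p' acts on it as 1. Faithfulness gives p p' p = p. *)
Lemma bicharacter_idem_absorb K H b K' H' b' :
    bicharacter_on w K H b -> bicharacter_on w K' H' b' ->
    (forall M : td_module w,
      bicharacter_class K H b M -> bicharacter_class K' H' b' M) ->
  bicharacter_idem w K' H' b' * bicharacter_idem w K H b = bicharacter_idem w K H b.
Proof.
move=> B B' sub; set p := bicharacter_idem w K H b; set p' := bicharacter_idem w _ _ b'.
pose q := td_regular w p.
have pp : p * p = p := bicharacter_idemM B (cardG_neq0 H).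
have qq : q *m q = q by rewrite /q -td_actM pp.
have hq : td_hom (col_base q *m row_base q : 'M_(td_dim (td_regular w))).
  by move=> d; rewrite mulmx_base /q -!td_actM (bicharacter_idemC B (cardG_neq0 H)).
have RC := idempotent_baseK qq.
have : bicharacter_class K' H' b' (td_retract RC hq).
  apply: sub; apply/(bicharacter_class_idem B (cardG_neq0 H)).
  by rewrite /= /retract_act -/q row_base_idem.
move/(bicharacter_class_idem B' (cardG_neq0 H')).
rewrite /= /retract_act -/p'.
move/(congr1 (fun A => col_base q *m A *m row_base q)).
rewrite mulmx1 mulmx_base base_sandwich.
rewrite /q -!td_actM => /td_regular_inj.
by rewrite (bicharacter_idemC B (cardG_neq0 H)) -mulrA pp.
Qed.

End ClassInjective.

(** * The triple of a fusion subcategory *)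

Section SubcategoryTriple.
Variables (gT : finGroupType) (k : fieldType) (w : normalized_cocycle3 gT k).
Variable F : fusion_subcategory w.
Local Notation basis := (td_basis w).
Local Notation beta := (beta w).
Local Notation gamma := (gamma w).
Local Notation graded := (graded_coef F).
Implicit Types (a x y z h : gT) (M : td_module w) (phi psi : gT -> k).

Definition fsub_K : {set gT} := [set a | `[< exists2 phi, graded a phi & phi 1%g != 0 >]].
(** These are the common periods of the coefficients of degree 1: comparison at 1 suffices since
    translates are again coefficients. *)
Definition fsub_H : {set gT} :=
  [set h | `[< forall phi, graded 1%g phi -> phi h = phi 1%g >]].

Lemma fsub_KP a : reflect (exists2 phi, graded a phi & phi 1%g != 0) (a \in fsub_K).
Proof. by rewrite inE; apply: asboolP. Qed.

Lemma fsub_HP h :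
  reflect (forall phi, graded 1%g phi -> phi h = phi 1%g) (h \in fsub_H).
Proof. by rewrite inE; apply: asboolP. Qed.

(** Right translation by x moves the point x to 1, so [fsub_K] consists of all degrees that
    occur. *)
Lemma mem_fsub_K a phi x : graded a phi -> phi x != 0 -> a \in fsub_K.
Proof.
move=> ga nz; apply/fsub_KP; exists (fun z => beta a z x * phi (z * x)%g).
  exact: graded_coef_right.
by rewrite beta_1 mul1r mul1g.
Qed.

Lemma graded1_left phi y : graded 1%g phi -> graded 1%g (fun x => phi (y * x)%g).
Proof.
move=> /(graded_coef_left y); rewrite conj1g; apply: eq_graded_coef => x.
by rewrite beta_1l mul1r.
Qed.

Lemma graded1_right phi y : graded 1%g phi -> graded 1%g (fun x => phi (x * y)%g).
Proof.
move=> /(graded_coef_right y); apply: eq_graded_coef => x.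
by rewrite beta_1l mul1r.
Qed.

Lemma gamma_1l x a : gamma x 1%g a = 1.
Proof.
by rewrite gammaE conj1g !cocycle3_1l cocycle3_norm mul1r divr1.
Qed.

Lemma graded1_mul a phi psi : graded 1%g phi -> graded a psi ->
  graded a (fun x => phi x * psi x).
Proof.
move=> g1 /(graded_coefM g1); rewrite mul1g; apply: eq_graded_coef => x.
by rewrite gamma_1l mul1r.
Qed.

Lemma fsub_K_group_set : group_set fsub_K.
Proof.
apply/group_setP; split=> [|a c /fsub_KP[phi gp p1] /fsub_KP[psi gq q1]].
  by apply: mem_fsub_K 1%g (graded_coef1 F) _; rewrite oner_eq0.
apply: mem_fsub_K 1%g (graded_coefM gp gq) _.
by rewrite gamma_1 mul1r mulf_neq0.
Qed.
Canonical fsub_K_group := Group fsub_K_group_set.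

Lemma fsub_H_group_set : group_set fsub_H.
Proof.
apply/group_setP; split=> [|h1 h2 /fsub_HP H1 /fsub_HP H2]; apply/fsub_HP=> // phi gp.
by rewrite (H1 _ (graded1_right h2 gp)) mul1g H2.
Qed.
Canonical fsub_H_group := Group fsub_H_group_set.

Lemma fsub_K_normal : (fsub_K <| [set: gT])%g.
Proof.
rewrite /normal subsetT; apply/subsetP=> y _; rewrite inE.
apply/subsetP=> _ /imsetP[a /fsub_KP[phi gp p1] ->].
apply: mem_fsub_K y^-1%g (graded_coef_left y gp) _.
by rewrite mulgV mulf_neq0 ?beta_neq0.
Qed.

Lemma fsub_H_normal : (fsub_H <| [set: gT])%g.
Proof.
rewrite /normal subsetT; apply/subsetP=> y _; rewrite inE.
apply/subsetP=> _ /imsetP[h /fsub_HP hH ->]; apply/fsub_HP=> phi gp.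
have := hH _ (graded1_right y (graded1_left y^-1%g gp)).
by rewrite /= mul1g mulVg conjgE.
Qed.

(** For g outside H some psi of degree 1 has psi g != psi 1, and (psi - psi g) / (psi 1 - psi g) is
    1 on H and 0 at g. The indicator is the product of these functions. *)
Lemma graded1_indicator : graded 1%g (fun x => (x \in fsub_H)%:R).
Proof.
suff [phi [gp pH pN]] : exists phi, [/\ graded 1%g phi,
    forall h, h \in fsub_H -> phi h = 1 &
    forall g, g \in enum gT -> g \notin fsub_H -> phi g = 0].
  apply: eq_graded_coef gp => x; have [xH | xH] := boolP (x \in fsub_H).
    exact: pH.
  by rewrite pN ?mem_enum.
elim: (enum gT) => [|g s [phi [gp pH pN]]].
  by exists (fun=> 1); split=> //; apply: graded_coef1.
have [gH | gH] := boolP (g \in fsub_H).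
  exists phi; split=> // x; rewrite inE => /predU1P[-> /negP[] //|]; exact: pN.
have [psi gq qg] : exists2 psi, graded 1%g psi & psi g != psi 1%g.
  have [//|none] := pselect (exists2 psi, graded 1%g psi & psi g != psi 1%g).
  case/fsub_HP: gH => psi gq; apply/eqP/negPn/negP=> qg.
  by apply: none; exists psi.
have nz : psi 1%g - psi g != 0 by rewrite subr_eq0 eq_sym.
exists (fun x => (psi 1%g - psi g)^-1 * (psi x + - psi g * 1) * phi x); split.
- by apply: graded1_mul => //; apply/graded_coefZ/graded_coefD/graded_coefZ/graded_coef1.
- by move=> h hH; rewrite pH // (fsub_HP _ hH) // !mulr1 mulVf.
- move=> x; rewrite inE => /predU1P[-> _|xs xH]; last by rewrite pN ?mulr0.
  by rewrite mulr1 subrr mulr0 mul0r.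
Qed.

(* The coefficients of degrees a and a^-1 multiply to functions that are constant
   on H, which leaves on H a single coefficient of degree a up to scalars. *)
Lemma fsub_char_exists a : a \in fsub_K -> exists phi, [/\ graded a phi,
  phi 1%g = 1, forall x, x \notin fsub_H -> phi x = 0,
  forall h, h \in fsub_H -> phi h != 0 &
  forall psi h, graded a psi -> h \in fsub_H -> psi h = psi 1%g * phi h].
Proof.
have bump c : c \in fsub_K -> exists phi, [/\ graded c phi,
    phi 1%g = 1 & forall x, x \notin fsub_H -> phi x = 0].
  case/fsub_KP=> phi gp p1; exists (fun x => (x \in fsub_H)%:R * ((phi 1%g)^-1 * phi x)).
  split; first by apply/(graded1_mul graded1_indicator)/graded_coefZ.
    by rewrite group1 mul1r mulVf.
  by move=> x /negPf->; rewrite mul0r.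
move=> aK; have [phi [gp p1 pN]] := bump a aK.
have [|chi [gc c1 _]] := bump a^-1%g; first by rewrite groupV.
have const psi h : graded a psi -> h \in fsub_H ->
    gamma h a a^-1%g * (psi h * chi h) = psi 1%g.
  move=> gq hH; have := graded_coefM gq gc; rewrite mulgV => /(fsub_HP _ hH) ->.
  by rewrite gamma_1 c1 mul1r mulr1.
have phi_unit h : h \in fsub_H -> gamma h a a^-1%g * (phi h * chi h) = 1.
  by move=> hH; rewrite const.
exists phi; split=> // [h hH | psi h gq hH].
  apply/eqP=> ph0; have /eqP := phi_unit h hH.
  by rewrite ph0 mul0r mulr0 eq_sym oner_eq0.
by rewrite -(const psi h gq hH) -{1}[psi h]mulr1 -(phi_unit h hH); ring.
Qed.

(** Each identity is the uniqueness in [fsub_char_exists], applied to a translate or a product whose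
    value at 1 is known. *)
Lemma fsub_bicharacter : exists b, bicharacter_on w fsub_K_group fsub_H_group b /\
  forall a, a \in fsub_K -> [/\ graded a (b a), b a 1%g = 1,
    forall x, x \notin fsub_H -> b a x = 0 &
    forall psi h, graded a psi -> h \in fsub_H -> psi h = psi 1%g * b a h].
Proof.
have : forall a, exists phi, a \in fsub_K -> [/\ graded a phi,
  phi 1%g = 1, forall x, x \notin fsub_H -> phi x = 0,
  forall h, h \in fsub_H -> phi h != 0 &
  forall psi h, graded a psi -> h \in fsub_H -> psi h = psi 1%g * phi h].
  move=> a; have [aK | //] := boolP (a \in fsub_K); last by exists (fun=> 0).
  by have [phi] := fsub_char_exists aK; exists phi.
case/choice=> b bP; exists b; split; last by move=> a /bP[].
have conjK a x : ((a ^ x)%g \in fsub_K) = (a \in fsub_K).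
  by rewrite memJ_norm // (subsetP (normal_norm fsub_K_normal)) ?inE.
have conj a h : a \in fsub_K -> h \in fsub_H -> (a ^ h)%g = a.
  move=> aK hH; have [ga a1 _ nz uniq] := bP a aK.
  (* The part of [b a] on the x with a ^ x = a keeps its value at 1, hence also its nonzero value at
     h. *)
  have := uniq _ h (graded_coef_conj a ga) hH; rewrite conjg1 eqxx a1 mul1r.
  by case: eqP => // _ e; case/eqP: (nz h hH).
split.
- exact: fsub_K_normal.
- exact: fsub_H_normal.
- apply/centsP=> h hH a aK; apply/commute_sym/commgP/conjg_fixP.
  exact: conj.
- by move=> a h aK hH; have [_ _ _ nz _] := bP a aK; apply: nz.
- move=> a y z aK yH zH; have [ga a1 _ nz uniq] := bP a aK.
  have := uniq _ y (graded_coef_right z ga) yH; rewrite mul1g beta_1 mul1r => e.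
  apply: (mulfI (beta_neq0 w a y z)); rewrite e.
  by field; rewrite beta_neq0.
- move=> v x y vK xK yH; have [gv v1 _ _ _] := bP v vK; have [gx x1 _ _ _] := bP x xK.
  have [_ _ _ _ uniq] := bP (v * x)%g (groupM vK xK).
  have := uniq _ y (graded_coefM gv gx) yH.
  by rewrite v1 x1 gamma_1 !mul1r gamma_beta ?conj // mulrA.
move=> x l h lK hH; have [gl l1 _ _ _] := bP l lK.
have [_ _ _ _ uniq] := bP (l ^ x)%g (etrans (conjK l x) lK).
(* Left translation by x changes the degree to l ^ x; right translation by x^-1 makes the value at 1
   equal to [beta l x x^-1]. *)
have := uniq _ h (graded_coef_right x^-1%g (graded_coef_left x gl)) hH.
rewrite mul1g mulgV l1 beta_1 mul1r mulr1 mulgA => e.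
apply: (mulfI (beta_neq0 w l x x^-1%g)); rewrite -e mulrA -beta_cocycle.
rewrite conjgE invgK !mulgA.
by field; rewrite beta_neq0.
Qed.

(** Uniqueness puts the objects of [F] in the class. Conversely, a coefficient of a module in the
    class is H-equivariant in each degree, hence a combination of right translates of the [b a], and
    [fsub_of_coef] applies. *)
Lemma fsub_bicharacterP : has_pchar0 k ->
  exists b, bicharacter_on w fsub_K_group fsub_H_group b /\
  forall M, F M <-> bicharacter_class fsub_K_group fsub_H_group b M.
Proof.
move=> char0; have [b [bb bP]] := fsub_bicharacter; exists b; split=> // M.
split=> [FM | cM].
  have gM a i j : graded a (fun x => M (basis a x) i j).
    exact: graded_component (fsub_coef_entry i j FM).
  split=> [a aK | a h aK hH]; apply/matrixP=> i j; rewrite !mxE.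
    by apply/eqP/negPn; apply: contra aK => nz; apply: mem_fsub_K (gM a i j) nz.
  by have [_ _ _ uniq] := bP a aK; rewrite (uniq _ h (gM a i j)) // mulrC.
apply: fsub_of_coef => [|i j].
  by rewrite -cardsT (cardG_neq0 char0 [set: gT]%G).
pose f a x : k := M (basis a x) i j; change (fsub_coef F f).
have fH a h x : a \in fsub_K -> h \in fsub_H ->
    beta a h x * f a (h * x)%g = b a h * f a x.
  move=> aK hH; have [_ MB] := cM.
  have := congr1 (fun A => (A *m M (basis a x)) i j) (MB a h aK hH).
  rewrite -scalemxAl -!td_actM td_basis1M td_basisMJ (bion_conjg bb aK hH) eqxx.
  by rewrite linearZ !mxE.
pose g a y c x := if c == a then beta a x y^-1%g * b a (x * y^-1)%g else 0.
have gg a y : a \in fsub_K -> fsub_coef F (g a y).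
  by move=> aK; have [ga _ _ _] := bP a aK; apply: graded_coef_right ga.
(* For a in K, the translate [g a y a] vanishes off the coset H y and is [beta a y y^-1] at y; |H|
   accounts for the size of the coset. *)
pose t a y := if a \in fsub_K then (#|fsub_H|%:R * beta a y y^-1%g)^-1 * f a y else 0.
have : fsub_coef F (fun c x => \sum_a \sum_y t a y * g a y c x).
  apply: fsub_coef_sum => a; apply: fsub_coef_sum => y; rewrite /t.
  case: ifP => aK; first exact/fsub_coefZ/gg.
  by apply: eq_fsub_coef (fsub_coef0 F) => c x; rewrite mul0r.
apply: eq_fsub_coef => c x; rewrite (bigD1 c) //= [X in _ + X]big1 ?addr0; last first.
  by move=> a /negPf ac; apply: big1 => y _; rewrite /g eq_sym ac mulr0.
rewrite /t /g eqxx; have [cK | cK] := boolP (c \in fsub_K); last first.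
  rewrite big1 => [|y _]; last by rewrite mul0r.
  by rewrite /f (bicharacter_class_out _ cM) ?mxE.
have [_ _ bN _] := bP c cK.
(* With y = h^-1 x one has x y^-1 = h, so only h in H contribute. *)
rewrite (reindex_inj (inj_comp (mulIg x) invg_inj)) /= (bigID (mem fsub_H)) /=.
rewrite [X in _ + X]big1 ?addr0 => [|h hH]; last first.
  by rewrite bN ?mulr0 // invMg invgK mulKVg.
rewrite (eq_bigr (fun=> (#|fsub_H|%:R)^-1 * f c x)) => [|h hH].
  rewrite sumr_const -(mulr_natr (_ * _)) mulrAC mulVf ?mul1r //.
  exact: (cardG_neq0 char0 fsub_H_group).
set y := (h^-1 * x)%g; have hy : (h * y)%g = x by rewrite /y mulKVg.
have -> : (x * y^-1)%g = h by rewrite /y invMg invgK mulKVg.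
have e1 := fH c h y cK hH; have e2 := beta_cocycle w c h y y^-1%g.
rewrite hy mulgV beta_1r mulr1 (bion_conjg bb cK hH) in e1 e2.
transitivity ((#|fsub_H|%:R * beta c y y^-1%g)^-1 * beta c x y^-1%g * (b c h * f c y)).
  by ring.
rewrite -e1 -e2; field.
by rewrite !beta_neq0 (cardG_neq0 char0 fsub_H_group).
Qed.

End SubcategoryTriple.

(** * The bijection between triples and fusion subcategories *)

Section Triples.
Variables (gT : finGroupType) (k : fieldType) (w : normalized_cocycle3 gT k).
Hypothesis char0 : has_pchar0 k.
Local Notation beta := (beta w).

(** The two central idempotents absorb each other, so they are equal; their support and coefficients
    give back the triple. *)
Lemma bicharacter_class_inj (K H : {group gT}) b (K' H' : {group gT}) b' :
    bicharacter_on w K H b -> bicharacter_on w K' H' b' ->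
    (forall M : td_module w, bicharacter_class K H b M <-> bicharacter_class K' H' b' M) ->
  [/\ K = K', H = H' & forall x y, x \in K -> y \in H -> b x y = b' x y].
Proof.
move=> B B' cE.
have := bicharacter_idemC B (cardG_neq0 char0 H) (bicharacter_idem w K' H' b').
rewrite (bicharacter_idem_absorb char0 B B'); last by move=> M /cE.
rewrite (bicharacter_idem_absorb char0 B' B); last by move=> M /cE.
move/esym/ffunP=> pp; have nH := cardG_neq0 char0.
have pE x y : ((x \in K) && (y \in H)) = ((x \in K') && (y \in H')).
  have := pp (x, y); rewrite !ffunE /=.
  have nz (L : {group gT}) (c : k) : c != 0 -> (#|L|%:R * c)^-1 != 0.
    by move=> c0; rewrite invr_eq0 mulf_neq0.
  case: ifP => [/andP[xK yH]|_]; case: ifP => [/andP[xK' yH']|_] // /eqP.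
    by rewrite (negPf (nz H _ (bion_neq0 B xK yH))).
  by rewrite eq_sym (negPf (nz H' _ (bion_neq0 B' xK' yH'))).
have eK : K = K'.
  by apply/group_inj/setP=> x; have := pE x 1%g; rewrite !group1 !andbT.
have eH : H = H'.
  by apply/group_inj/setP=> y; have := pE 1%g y; rewrite !group1.
split=> // x y xK yH; have := pp (x, y); rewrite !ffunE /= -pE xK yH /= eH.
by move/invr_inj/(mulfI (nH _ _)) => ->.
Qed.

Definition total_bicharacter (T : bicharacter_triple w) (x y : gT) : k :=
  bt_B (subg (bt_K T) x) (subg (bt_H T) y).

Lemma total_bicharacterP (T : bicharacter_triple w) :
  bicharacter_on w (bt_K T) (bt_H T) (total_bicharacter T).
Proof.
case: T => K H B nK nH cKH [B0 Br Bl] Binv; rewrite /total_bicharacter /=.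
split=> //.
- move=> x y z xK yH zH.
  have -> : subg H (y * z)%g = (subg H y * subg H z)%g by rewrite -morphM.
  by rewrite Br !subgK.
- move=> v x y vK xK yH.
  have -> : subg K (v * x)%g = (subg K v * subg K x)%g by rewrite -morphM.
  by rewrite Bl !subgK.
move=> x l h lK hH.
have := Binv x (subg K l) (subg H h); rewrite /= !subgK //.
by rewrite !conjgE invgK !mulgA.
Qed.

Definition triple_fsub (T : bicharacter_triple w) : fusion_subcategory w :=
  bicharacter_fsub (total_bicharacterP T).

Lemma triple_fsub_inj : injective triple_fsub.
Proof.
move=> T T' eT.
have cE (M : td_module w) : triple_fsub T M <-> triple_fsub T' M by rewrite eT.
have [] := bicharacter_class_inj (total_bicharacterP T) (total_bicharacterP T') cE.
case: T T' {eT cE} => K H B nK nH cKH bB iB [K' H' B' nK' nH' cKH' bB' iB'] /=.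
move=> eK eH; subst K' H'; rewrite /total_bicharacter /= => eB.
have {}eB : B = B'.
  apply/funext=> s; apply/funext=> t.
  by have := eB _ _ (subgP s) (subgP t); rewrite !sgvalK.
by subst B'; congr BicharacterTriple; apply: Prop_irrelevance.
Qed.

(** Only the classes are compared, since restricting [b] to K x H forgets its junk values. *)
Lemma bicharacter_on_triple (K H : {group gT}) b : bicharacter_on w K H b ->
  exists T : bicharacter_triple w,
    forall M, triple_fsub T M <-> bicharacter_class K H b M.
Proof.
move=> B; pose B0 (s : subg_of K) (t : subg_of H) := b (sgval s) (sgval t).
have bB0 : omega_bicharacter w B0.
  split=> [s t | s t u | s t u].
  - exact: (bion_neq0 B (subgP s) (subgP t)).
  - by rewrite /B0 morphM ?inE // (bion_mulr B) ?subgP.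
  - by rewrite /B0 morphM ?inE // (bion_mull B) ?subgP.
have iB0 : G_invariant w B0.
  move=> x s t /=; rewrite /B0.
  have -> : (x^-1 * sgval s * x = sgval s ^ x)%g by rewrite conjgE mulgA.
  have -> : (x * sgval t * x^-1 = sgval t ^ x^-1)%g by rewrite conjgE invgK mulgA.
  by rewrite !subgK ?(bion_memJK B) ?(bion_memJH B) ?subgP // (bion_conj B) ?subgP.
pose T := BicharacterTriple (bion_normalK B) (bion_normalH B) (bion_cent B) bB0 iB0.
exists T => M; rewrite /= /bicharacter_class /total_bicharacter /= /B0.
by split=> -[M0 MB]; split=> // a h aK hH; rewrite MB ?subgK.
Qed.

Lemma triple_fsub_surj (F : fusion_subcategory w) :
  exists T, triple_fsub T = F.
Proof.
have [b [B FE]] := fsub_bicharacterP F char0.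
have [T TE] := bicharacter_on_triple B; exists T.
have : fsub (triple_fsub T) = fsub F.
  by apply/funext=> M; apply/propext; rewrite TE FE.
case: (triple_fsub T) F {b B FE TE} => f ? ? ? ? ? ? ? [f' ? ? ? ? ? ? ?] /= ff'.
by subst f'; congr FusionSubcategory; apply: Prop_irrelevance.
Qed.

End Triples.

Theorem theorem1p2 (gT : finGroupType) (k : closedFieldType)
    (char0 : has_pchar0 k) (w : normalized_cocycle3 gT k) :
  exists F : fusion_subcategory w -> bicharacter_triple w, bijective F.
Proof.
(* A right inverse of [triple_fsub], which is two-sided by injectivity. *)
have [F FK] := choice (triple_fsub_surj (w := w) char0).
exists F; exists (triple_fsub (w := w)) => // T.
exact: triple_fsub_inj.
Qed.
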